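(* There exists a universal constant $C\le5$ such that the following holds. In the setting given in the context, suppose that $\Theta\subseteq\{\theta\in\mathbb R^d:\|\theta\|_2\le R\}$, that $\mu$ is uniform on the surface of the $\ell_2$-ball of radius $\sqrt d$ centered at $0$, and that $\mathbb E[\|\mathsf g(\theta;X)\|_2^2]\le G^2$ for all $\theta\in\Theta$. Let $m\ge1$ be an integer, let $Z^{t,i}$, $i=1,\dots,m$, $t=1,2,\dots$, be sampled independently according to $\mu$ (independently of the $X^t$), let $\alpha,u>0$, and let $\{\theta^t\}$ be generated from an arbitrary $\theta^1\in\Theta$ by $$\theta^{t+1}=\operatorname*{argmin}_{\theta\in\Theta}\Big\{\langle g^t,\theta\rangle+\frac{1}{2\alpha(t)}\|\theta-\theta^t\|_2^2\Big\},\qquad g^t=\frac1m\sum_{i=1}^m\frac{F(\theta^t+u_tZ^{t,i};X^t)-F(\theta^t;X^t)}{u_t}Z^{t,i},$$ with $$\alpha(t)=\alpha\,\frac{R}{2G\max\{\sqrt{d/m},1\}}\cdot\frac1{\sqrt t},\qquad u_t=u\,\frac{G}{L(P)\,d^{3/2}}\cdot\frac1t .$$ Then for all $k\ge1$, with $\widehat\theta(k)=\frac1k\sum_{t=1}^k\theta^t$, $$\mathbb E\big[f(\widehat\theta(k))-f(\theta^* )\big]\le C\,\frac{RG\sqrt{1+d/m}}{\sqrt k}\left[\max\{\alpha,\alpha^{-1}\}+\alpha u^2\frac1{\sqrt k}+u\,\frac{\log(2k)}{k}\right].$$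
   Context: Problem: $\Theta\subseteq\mathbb R^d$ is a compact convex set, $P$ is a probability distribution on a space $\mathcal X$, for $P$-almost every $x$ the function $F(\cdot;x)$ is closed and convex, $f(\theta)=\mathbb E_P[F(\theta;X)]$, and $\theta^*$ is a minimizer of $f$ over $\Theta$. $X^1,X^2,\dots$ are i.i.d. from $P$. $\mathsf g(\theta;x)\in\partial F(\theta;x)$ is a measurable subgradient selection with $\mathbb E[\mathsf g(\theta;X)]\in\partial f(\theta)$. Standing assumptions: the proximal function is $\psi(\theta)=\frac12\|\theta\|_2^2$, with Bregman divergence $D_\psi(\theta,\tau)=\frac12\|\theta-\tau\|_2^2$, and $D_\psi(\theta^*,\theta)\le\frac12R^2$ for all $\theta\in\Theta$ (that is, $\|\theta-\theta^*\|_2\le R$). $\operatorname{dom}F(\cdot;x)\supset\Theta+u_1\operatorname{supp}\mu$ for all $x\in\mathcal X$. There is $L:\mathcal X\to\mathbb R_+$ such that for $P$-a.e. $x$ the gradient of $F(\cdot;x)$ is $L(x)$-Lipschitz with respect to $\|\cdot\|_2$, and $L(P)=\sqrt{\mathbb E[L(X)^2]}$ is finite. The constants $R,G,L(P)$ are positive. *)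

(* Defs.v *)
From HB Require Import structures.
From mathcomp Require Import all_boot all_order all_algebra.
From mathcomp Require Import all_classical all_reals all_analysis.
From mathcomp Require Import measurable_realfun.
Set Implicit Arguments.
Unset Strict Implicit.
Unset Printing Implicit Defensive.
Import Order.TTheory GRing.Theory Num.Theory.
Import numFieldNormedType.Exports.
Local Open Scope classical_set_scope.
Local Open Scope ring_scope.

(* R^d is 'rV[R]_d; its library topology (sup norm) is the Euclidean one, and
   it is given the Borel sigma-algebra. *)
HB.instance Definition _ (R : realType) (d : nat) :=
  @isMeasurable.Build (sigma_display (@open 'rV[R]_d)) 'rV[R]_d
    <<s (@open 'rV[R]_d) >> (@sigma_algebra0 _ setT _) (fun A => @sigma_algebraC _ _ A)
    (@sigma_algebra_bigcup _ setT _).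

Section Euclidean.
Context {R : realType} {d : nat}.
Implicit Types (x y v : 'rV[R]_d) (phi : 'rV[R]_d -> \bar R).

Definition dotp x y : R := \sum_i x 0 i * y 0 i.

(* The library norm on 'rV[R]_d is the sup norm. *)
Definition l2norm x : R := Num.sqrt (dotp x x).

Definition edom phi : set 'rV[R]_d := [set x | (phi x < +oo)%E].

Definition epigraph phi : set ('rV[R]_d * R^o) :=
  [set p | (phi p.1 <= p.2%:E)%E].

Definition closed_convex_fun phi : Prop :=
  [/\ forall x, phi x != -oo%E, closed (epigraph phi) &
      convex_set (epigraph phi : set (convex_lmodType ('rV[R]_d * R^o)%type))].

Definition subdifferential phi x : set 'rV[R]_d :=
  [set v | phi x \is a fin_num /\
           forall y, (phi x + (dotp v (y - x))%:E <= phi y)%E].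

Definition gradient (h : 'rV[R]_d -> R^o) x : 'rV[R]_d :=
  \row_i 'D_(delta_mx 0 i) h x.

(* [phi] may be infinite away from its domain, so differentiability and the
   Lipschitz bound are required on the interior of the domain. *)
Definition lipschitz_gradient phi (L : R) : Prop :=
  let h : 'rV[R]_d -> R^o := fun x => fine (phi x) in
  (forall x, (edom phi)° x -> differentiable h x) /\
  (forall x y, (edom phi)° x -> (edom phi)° y ->
     l2norm (gradient h x - gradient h y) <= L * l2norm (x - y)).

End Euclidean.

Definition is_argmin (T : Type) (disp : Order.disp_t) (E : porderType disp)
    (A : set T) (h : T -> E) (a : T) : Prop :=
  A a /\ forall b, A b -> (h a <= h b)%O.

(* The uniform distribution on a sphere centered at 0: the (unique) Borel
   probability carried by the sphere and invariant under every orthogonal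
   transformation. *)
Definition uniform_on_sphere (R : realType) (d : nat)
    (mu : probability 'rV[R]_d R) (r : R) : Prop :=
  mu [set z | l2norm z = r] = 1%E /\
  forall Q : 'M[R]_d, Q *m Q^T = 1%:M ->
    forall A : set 'rV[R]_d, measurable A ->
      mu ((fun z => z *m Q) @^-1` A) = mu A.

Definition msupport (R : realType) (d : nat)
    (mu : probability 'rV[R]_d R) : set 'rV[R]_d :=
  [set z | forall U : set 'rV[R]_d, open U -> U z -> (0 < mu U)%E].

Definition has_law (dW dT : measure_display) (W : measurableType dW)
    (T : measurableType dT) (R : realType) (Pr : probability W R)
    (Y : W -> T) (Q : probability T R) : Prop :=
  measurable_fun setT Y /\
  forall A : set T, measurable A -> Pr (Y @^-1` A) = Q A.

(* Mutual independence of a family of classes of events; a class is meant to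
   be the sigma-algebra generated by a random element, so that elements with
   different target spaces can be put in one family. *)
Definition mutually_independent (dW : measure_display)
    (W : measurableType dW) (R : realType) (Pr : probability W R)
    (I : choiceType) (S : I -> set (set W)) : Prop :=
  forall (s : seq I) (A : I -> set W), uniq s ->
    (forall i, i \in s -> S i (A i)) ->
    Pr (\big[setI/setT]_(i <- s) A i) = (\prod_(i <- s) Pr (A i))%E.

Definition sigma_of (dT : measure_display) (W : Type)
    (T : measurableType dT) (Y : W -> T) : set (set W) :=
  preimage_set_system setT Y measurable.

(* The sigma-algebras of X^t and Z^(t,i) for t >= 1; index t stands for
   time t.+1. *)
Definition sample_sigma (dX dV : measure_display) (W : Type)
    (X : measurableType dX) (V : measurableType dV) (m : nat)
    (Xs : nat -> W -> X) (Zs : nat -> 'I_m -> W -> V)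
    (j : (nat + nat * 'I_m)%type) : set (set W) :=
  match j with
  | inl t => sigma_of (Xs t.+1)
  | inr (t, i) => sigma_of (Zs t.+1 i)
  end.

Section Algorithm.
Context {R : realType} {d : nat}.

(* [fine] is only meaningful on the domain of F(.; x), which almost surely
   contains the two query points. *)
Definition grad_estimate (X : Type) (F : 'rV[R]_d -> X -> \bar R) (m : nat)
    (u : R) (theta : 'rV[R]_d) (x : X) (z : 'I_m -> 'rV[R]_d) : 'rV[R]_d :=
  m%:R^-1 *: \sum_(i < m)
    ((fine (F (theta + u *: z i) x) - fine (F theta x)) / u) *: z i.

Definition prox_objective (a : R) (g theta0 theta : 'rV[R]_d) : R :=
  dotp g theta + (2 * a)^-1 * l2norm (theta - theta0) ^+ 2.

End Algorithm.

Definition step_size (R : realType) (d m : nat) (rad G alpha : R) (t : nat) : R :=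
  alpha * (rad / (2 * G * Num.max (Num.sqrt (d%:R / m%:R)) 1))
        * (Num.sqrt t%:R)^-1.

Definition smoothing (R : realType) (d : nat) (G LP u : R) (t : nat) : R :=
  u * (G / (LP * d%:R `^ (3 / 2))) * t%:R^-1.

(* Main.v *)
(** Writing [ghat] for the finite-difference estimate, one proximal step gives
    [|theta_{t+1} - theta*|^2 <= |theta_t - alpha_t ghat_t - theta*|^2].  The
    right-hand side is a nonnegative function of the past iterate [theta_t] and
    of the independent present samples, so Tonelli reduces its mean to a fixed
    point [theta_t = th].  There, convexity and the Lipschitz gradient give
    [ghat = (1/m) sum_i <g, Z_i> Z_i + e] with [|e| <= u_t L(x) d^(3/2)], and
    rotation invariance ([E Z Z^T = 1]) gives mean [<E g, th - theta*>] for the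
    linear term and [(1 + (d-1)/m) E|g|^2] for the quadratic one.  Summing over
    [t] with telescoping yields the rate. *)
Require Import Defs.
From HB Require Import structures.
From mathcomp Require Import all_boot all_order all_algebra.
From mathcomp Require Import all_classical all_reals all_analysis.
From mathcomp Require Import measurable_realfun ring lra.
Set Implicit Arguments.
Unset Strict Implicit.
Unset Printing Implicit Defensive.
Import Order.TTheory GRing.Theory Num.Theory.
Import numFieldNormedType.Exports.
Local Open Scope classical_set_scope.
Local Open Scope ring_scope.

(** * Euclidean structure of row vectors *)

(** The selection [g] is measurable in the sample for each fixed parameter only, so an expression
    with [g] at a random iterate cannot be integrated. The squared distance after the unprojected
    step involves [F] alone, which is jointly measurable; Tonelli is applied to that, and [g] enters
    once the parameter is frozen. Likewise the argmin is given outcome by outcome, with no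
    measurability: the proximal step is a projection, hence nonexpansive, and this makes every
    iterate measurable for the past samples. The gap at the average is not shown to be measurable
    either; it is bounded pointwise by a function that has a mean.

    The averaged smoothing bias has order [u log k / sqrt k] inside the bracket, more than
    [u log(2k) / k] can hold. Up to a factor it is at most [u / k^(1/4)], the geometric mean of
    [1/alpha] and [alpha u^2 / sqrt k], so AM-GM charges it to these two terms. The constant 5 is 1
    for the telescoped distances, 2 for the second moment of the estimate and 2 for the bias. *)

Lemma continuous_sumr (R : realType) (T : topologicalType) (I : Type)
    (r : seq I) (h : I -> T -> R) :
  (forall i, continuous (h i)) -> continuous (fun x => \sum_(i <- r) h i x).
Proof.
move=> ch; elim: r => [|i r IH].
  rewrite (_ : (fun _ => _) = cst 0); first by move=> x; exact: cvg_cst.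
  by apply/funext => x; rewrite big_nil.
rewrite (_ : (fun _ => _) = (fun x => h i x + \sum_(j <- r) h j x)).
  by move=> x; apply: cvgD; [exact: ch|exact: IH].
by apply/funext => x; rewrite big_cons.
Qed.

Section EuclideanAlgebra.
Context {R : realType} {d : nat}.
Implicit Types (x y v : 'rV[R]_d) (a : R).

Lemma dotpC x y : dotp x y = dotp y x.
Proof. by apply: eq_bigr => i _; rewrite mulrC. Qed.

Lemma dotpDl x y v : dotp (x + y) v = dotp x v + dotp y v.
Proof. by rewrite -big_split; apply: eq_bigr => i _; rewrite mxE mulrDl. Qed.

Lemma dotpZl a x v : dotp (a *: x) v = a * dotp x v.
Proof. by rewrite mulr_sumr; apply: eq_bigr => i _; rewrite mxE mulrA. Qed.

Lemma dotpNl x v : dotp (- x) v = - dotp x v.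
Proof. by rewrite -scaleN1r dotpZl mulN1r. Qed.

Lemma dotpBl x y v : dotp (x - y) v = dotp x v - dotp y v.
Proof. by rewrite dotpDl dotpNl. Qed.

Lemma dotpDr x y v : dotp v (x + y) = dotp v x + dotp v y.
Proof. by rewrite dotpC dotpDl !(dotpC v). Qed.

Lemma dotpZr a x v : dotp v (a *: x) = a * dotp v x.
Proof. by rewrite dotpC dotpZl (dotpC v). Qed.

Lemma dotpNr x v : dotp v (- x) = - dotp v x.
Proof. by rewrite dotpC dotpNl (dotpC v). Qed.

Lemma dotpBr x y v : dotp v (x - y) = dotp v x - dotp v y.
Proof. by rewrite dotpDr dotpNr. Qed.

Lemma dotp0l v : dotp 0 v = 0.
Proof. by rewrite -(scale0r 0) dotpZl mul0r. Qed.

Lemma dotp0r v : dotp v 0 = 0.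
Proof. by rewrite dotpC dotp0l. Qed.

Lemma dotp_suml (I : Type) (r : seq I) (p : pred I) (w : I -> 'rV[R]_d) v :
  dotp (\sum_(i <- r | p i) w i) v = \sum_(i <- r | p i) dotp (w i) v.
Proof.
by apply: (big_morph (fun z => dotp z v)) => [? ?|]; rewrite ?dotpDl ?dotp0l.
Qed.

Lemma dotp_sumr (I : Type) (r : seq I) (p : pred I) (w : I -> 'rV[R]_d) v :
  dotp v (\sum_(i <- r | p i) w i) = \sum_(i <- r | p i) dotp v (w i).
Proof. by rewrite dotpC dotp_suml; apply: eq_bigr => i _; rewrite dotpC. Qed.

Lemma dotp_ge0 x : 0 <= dotp x x.
Proof. by apply: sumr_ge0 => i _; rewrite -expr2 sqr_ge0. Qed.

Lemma l2norm_ge0 x : 0 <= l2norm x.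
Proof. exact: sqrtr_ge0. Qed.

Lemma sqr_l2norm x : l2norm x ^+ 2 = dotp x x.
Proof. by rewrite sqr_sqrtr// dotp_ge0. Qed.

Lemma l2normZ a x : l2norm (a *: x) = `|a| * l2norm x.
Proof.
by rewrite /l2norm dotpZl dotpZr mulrA -expr2 sqrtrM ?sqr_ge0// sqrtr_sqr.
Qed.

Lemma l2normN x : l2norm (- x) = l2norm x.
Proof. by rewrite /l2norm dotpNl dotpNr opprK. Qed.

Lemma l2norm0 : l2norm (0 : 'rV[R]_d) = 0.
Proof. by rewrite /l2norm dotp0l sqrtr0. Qed.

Lemma l2norm_eq0 x : l2norm x = 0 -> x = 0.
Proof.
move=> x0; have : dotp x x = 0 by rewrite -sqr_l2norm x0 expr0n.
move/eqP; rewrite psumr_eq0 => [/allP xi0|i _]; last by rewrite -expr2 sqr_ge0.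
apply/rowP => i; rewrite mxE; apply/eqP.
by have := xi0 i (mem_index_enum i); rewrite mulf_eq0 orbb.
Qed.

Lemma l2normBC x y : l2norm (x - y) = l2norm (y - x).
Proof. by rewrite -l2normN opprB. Qed.

Lemma dotp_le_l2norm x y : dotp x y <= l2norm x * l2norm y.
Proof.
have [/l2norm_eq0 ->|y0] := eqVneq (l2norm y) 0.
  by rewrite dotp0r l2norm0 mulr0.
have [/l2norm_eq0 ->|x0] := eqVneq (l2norm x) 0.
  by rewrite dotp0l l2norm0 mul0r.
have xy0 : 0 < l2norm x * l2norm y.
  by rewrite mulr_gt0// lt0r l2norm_ge0 ?x0 ?y0.
have := dotp_ge0 (l2norm y *: x - l2norm x *: y).
rewrite dotpBl !dotpBr !dotpZl !dotpZr -!sqr_l2norm (dotpC y x) => H.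
have : 0 <= 2 * (l2norm x * l2norm y) * (l2norm x * l2norm y - dotp x y).
  by move: H; congr (0 <= _); ring.
by rewrite pmulr_rge0 ?subr_ge0// mulr_gt0.
Qed.

Lemma abs_dotp_le x y : `|dotp x y| <= l2norm x * l2norm y.
Proof.
rewrite ler_norml dotp_le_l2norm andbT lerNl -dotpNl.
by rewrite (le_trans (dotp_le_l2norm _ _))// l2normN.
Qed.

Lemma l2normD_le x y : l2norm (x + y) <= l2norm x + l2norm y.
Proof.
rewrite -(@ler_pXn2r _ 2)// ?nnegrE ?addr_ge0 ?l2norm_ge0//.
rewrite sqr_l2norm dotpDl !dotpDr (dotpC y x) sqrrD -!sqr_l2norm.
have := dotp_le_l2norm x y; lra.
Qed.

Lemma l2norm_sum_le (I : Type) (r : seq I) (w : I -> 'rV[R]_d) :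
  l2norm (\sum_(i <- r) w i) <= \sum_(i <- r) l2norm (w i).
Proof.
elim: r => [|i r IH]; first by rewrite !big_nil l2norm0.
by rewrite !big_cons (le_trans (l2normD_le _ _))// lerD2l.
Qed.

Lemma sqr_l2normD_le x y :
  l2norm (x + y) ^+ 2 <= 2 * l2norm x ^+ 2 + 2 * l2norm y ^+ 2.
Proof.
have := dotp_ge0 (x - y).
rewrite !sqr_l2norm dotpBl !dotpBr dotpDl !dotpDr (dotpC y x); lra.
Qed.

Lemma coord_le_l2norm x i : `|x 0 i| <= l2norm x.
Proof.
rewrite -sqrtr_sqr ler_sqrt ?dotp_ge0// /dotp (bigD1 i)//= -expr2 lerDl.
by apply: sumr_ge0 => j _; rewrite -expr2 sqr_ge0.
Qed.

Lemma l2norm_coord_lt x y (i : 'I_1) (j : 'I_d) (e : R) :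
  l2norm (x - y) < e -> ball (x i j) e (y i j).
Proof.
move=> xye; rewrite /ball/= (le_lt_trans _ xye)// ord1.
by have := coord_le_l2norm (x - y) j; rewrite !mxE.
Qed.

Lemma l2norm_continuous : continuous (@l2norm R d).
Proof.
move=> x; apply: (continuous_comp (f := fun z => dotp z z)).
  apply: continuous_sumr => i z.
  have ci := @coord_continuous R 1 d 0 i z.
  exact: (cvgM ci ci).
exact: sqrt_continuous.
Qed.

Lemma open_l2ball x (e : R) : open [set y : 'rV[R]_d | l2norm (y - x) < e].
Proof.
have c1 : continuous (fun z : 'rV[R]_d => z - x).
  by move=> z; exact: (cvgB cvg_id (cvg_cst _)).
apply: (@open_comp _ _ (fun y => l2norm (y - x)) [set r : R | r < e]).
  move=> y _; exact: (continuous_comp (c1 y) (@l2norm_continuous _)).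
exact: open_lt.
Qed.

Lemma open_l2ball_sub (U : set 'rV[R]_d) x : open U -> U x ->
  exists2 e : R, 0 < e & [set y | l2norm (y - x) < e] `<=` U.
Proof.
move=> oU Ux; have : nbhs x U by apply: open_nbhs_nbhs.
move=> /nbhs_ballP[e /= e0 eU]; exists e => // y yx; apply: eU.
split=> // i j; apply: l2norm_coord_lt; by rewrite l2normBC.
Qed.

End EuclideanAlgebra.

(** * Borel sets of row vectors *)

Section BorelRowVectors.
Context {R : realType} {d : nat}.

Lemma measurable_rV_open (U : set 'rV[R]_d) : open U -> measurable U.
Proof. exact: sub_sigma_algebra. Qed.

Lemma measurable_rV_continuous (h : 'rV[R]_d -> R) :
  continuous h -> measurable_fun setT h.
Proof.
move=> ch; apply: (measurability _ (RGenOInfty.measurableE R)) => //.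
move=> _ [_ [a ->] <-]; rewrite setTI preimage_itvoy.
apply: measurable_rV_open; apply: (@open_comp _ _ h [set r | a < r]).
  by move=> x _; exact: ch.
exact: open_gt.
Qed.

Lemma measurable_coord (i : 'I_d) :
  measurable_fun setT (fun x : 'rV[R]_d => x 0 i).
Proof. by apply: measurable_rV_continuous; exact: coord_continuous. Qed.

Context {dT : measure_display} {T : measurableType dT}.

Let box (q : 'rV[rat]_d * nat) : set 'rV[R]_d :=
  [set y | forall i, `|y 0 i - ratr (q.1 0 i)| < q.2.+1%:R^-1].

Let box_near (U : set 'rV[R]_d) x : open U -> U x ->
  exists2 q, box q `<=` U & box q x.
Proof.
move=> oU Ux; have : nbhs x U by apply: open_nbhs_nbhs.
move=> /nbhs_ballP[e /= e0 eU].
(* Half of [e], because [x] and [y] are each compared with the rational centre of the cube. *)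
have [n ne] : exists n, n.+1%:R^-1 < e / 2.
  by have /ltr_add_invr[n]: 0 < e / 2 by [rewrite divr_gt0|]; rewrite add0r;
      exists n.
have n0 : 0 < n.+1%:R^-1 :> R by rewrite invr_gt0.
have qx i : {q : rat | `|x 0 i - ratr q| < n.+1%:R^-1}.
  have xn : x 0 i < x 0 i + n.+1%:R^-1 by rewrite ltrDl.
  have [q] := cid (rat_in_itvoo xn).
  rewrite in_itv/= => /andP[q1 q2]; exists q.
  by rewrite ltr0_norm ?subr_lt0// opprB ltrBlDl.
exists (\row_i sval (qx i), n) => /=.
  move=> y yq; apply: eU; split=> // i j; rewrite ord1 /ball/=.
  have := yq j; rewrite /= mxE => yqj.
  rewrite (splitr e) -(subrKA (ratr (sval (qx j)))) (le_lt_trans (ler_normD _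
      _))//.
  by rewrite ltrD ?(lt_trans (svalP (qx j)))// distrC (lt_trans yqj).
by move=> i; rewrite /= mxE; exact: svalP (qx i).
Qed.

(** The sigma-algebra is generated by the open sets, not by the coordinates, so second countability
    enters: an open set is the union of the countably many rational cubes [box q] inside it, and the
    preimage of a cube is a finite intersection of coordinate preimages. *)
Lemma measurable_fun_rV (h : T -> 'rV[R]_d) :
  (forall i, measurable_fun setT (fun w => h w 0 i)) -> measurable_fun setT h.
Proof.
move=> mh; apply: (@measurability _ _ _ _ _ _ (@open 'rV[R]_d)) => //.
move=> _ [U oU <-]; rewrite setTI.
rewrite (_ : _ @^-1` _ = \bigcup_q
    (if pselect (box q `<=` U) then h @^-1` box q else set0)); last first.
  apply/seteqP; split=> [w /= Uhw|w [q _]].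
    by have [q qU qw] := box_near oU Uhw; exists q => //; case: pselect.
  by case: pselect => // qU; exact: qU.
apply: countable_bigcupT_measurable => [|q]; first exact: countableP.
case: pselect => [qU|nqU]; last exact: measurable0.
rewrite (_ : _ @^-1` _ = \bigcap_(i in [set: 'I_d])
    ((fun w => h w 0 i) @^-1` [set r | `|r - ratr (q.1 0 i)| < q.2.+1%:R^-1]));
        last first.
  by apply/seteqP; split=> [w qw i _|w qw i]; exact: qw.
apply: fin_bigcap_measurable => // i _.
rewrite -[X in measurable X]setTI; apply: mh => //.
rewrite (_ : [set _ | _] =
  [set` `]ratr (q.1 0 i) - q.2.+1%:R^-1, ratr (q.1 0 i) + q.2.+1%:R^-1[%R]).
  exact: measurable_itv.
by apply/seteqP; split=> r /=; rewrite in_itv/= ltr_distl.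
Qed.

Lemma measurable_dotp (h1 h2 : T -> 'rV[R]_d) :
  measurable_fun setT h1 -> measurable_fun setT h2 ->
  measurable_fun setT (fun w => dotp (h1 w) (h2 w)).
Proof.
move=> m1 m2; apply: measurable_sum => i; apply: measurable_funM.
  exact: (measurableT_comp (measurable_coord i) m1).
exact: (measurableT_comp (measurable_coord i) m2).
Qed.

Lemma measurable_l2norm : measurable_fun setT (@l2norm R d).
Proof. by apply: measurable_rV_continuous; exact: l2norm_continuous. Qed.

Lemma measurable_rVD (h1 h2 : T -> 'rV[R]_d) :
  measurable_fun setT h1 -> measurable_fun setT h2 ->
  measurable_fun setT (fun w => h1 w + h2 w).
Proof.
move=> m1 m2; apply: measurable_fun_rV => i; under eq_fun do rewrite mxE.
apply: measurable_funD.
  exact: (measurableT_comp (measurable_coord i) m1).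
exact: (measurableT_comp (measurable_coord i) m2).
Qed.

Lemma measurable_rVZ (a : T -> R) (h : T -> 'rV[R]_d) :
  measurable_fun setT a -> measurable_fun setT h ->
  measurable_fun setT (fun w => a w *: h w).
Proof.
move=> ma mh; apply: measurable_fun_rV => i; under eq_fun do rewrite mxE.
apply: measurable_funM => //.
exact: (measurableT_comp (measurable_coord i) mh).
Qed.

Lemma measurable_rVB (h1 h2 : T -> 'rV[R]_d) :
  measurable_fun setT h1 -> measurable_fun setT h2 ->
  measurable_fun setT (fun w => h1 w - h2 w).
Proof.
move=> m1 m2; apply: measurable_rVD => //.
rewrite (_ : (fun _ => _) = fun w => (-1 : R) *: h2 w).
  by apply: measurable_rVZ => //; exact: measurable_cst.
by apply/funext => w; rewrite scaleN1r.
Qed.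

Lemma measurable_rV_sum (I : Type) (s : seq I) (h : I -> T -> 'rV[R]_d) :
  (forall i, measurable_fun setT (h i)) ->
  measurable_fun setT (fun w => \sum_(i <- s) h i w).
Proof.
move=> mh; apply: measurable_fun_rV => j; under eq_fun do rewrite summxE.
apply: measurable_sum => i.
exact: (measurableT_comp (measurable_coord j) (mh i)).
Qed.

End BorelRowVectors.

(** * Independence and means *)

Definition indep_systems (dW : measure_display) (W : measurableType dW)
    (R : realType) (Pr : probability W R) (S1 S2 : set (set W)) : Prop :=
  forall A B, S1 A -> S2 B -> Pr (A `&` B) = (Pr A * Pr B)%E.

Section IndependentSystems.
Context {dW : measure_display} {W : measurableType dW} {R : realType}.
Variable Pr : probability W R.
Implicit Types G H : set (set W).

Lemma indep_systemsC G H : indep_systems Pr G H -> indep_systems Pr H G.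
Proof. by move=> GH A B HA GB; rewrite setIC GH// muleC. Qed.

(** For fixed [B], the finite measures [A |-> Pr (A & B)] and [A |-> Pr B * Pr A] agree on the
    pi-system [G], hence on the sigma-algebra it generates. *)
Let indep_generatedl G H : setI_closed G -> G setT ->
  G `<=` measurable -> H `<=` measurable ->
  indep_systems Pr G H -> indep_systems Pr <<s G >> H.
Proof.
move=> GI GT Gm Hm GH A B GA HB; have mB := Hm _ HB.
have b0 : 0 <= fine (Pr B) by rewrite fine_ge0.
have bE : (fine (Pr B))%:E = Pr B by rewrite fineK// fin_num_measure.
have := @g_sigma_algebra_measure_unique _ R W G Gm (fun=> setT) (fun=> GT) _
  (mrestr Pr mB) (mscale (NngNum b0) Pr) GI _ _ A GA.
rewrite /mrestr/= /mscale/= bE muleC; apply.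
- by apply/seteqP; split=> // w _; exists 0%N.
- by move=> C GC; rewrite /mrestr/mscale/= GH// muleC.
- move=> _; rewrite /mrestr setTI; exact: (le_lt_trans (probability_le1 _ mB)
    (ltry _)).
Qed.

Lemma indep_generated G H : setI_closed G -> G setT -> setI_closed H -> H setT
    ->
  G `<=` measurable -> H `<=` measurable ->
  indep_systems Pr G H -> indep_systems Pr <<s G >> <<s H >>.
Proof.
move=> GI GT HI HT Gm Hm GH; apply: indep_generatedl => //.
  by apply: smallest_sub => //; exact: sigma_algebra_measurable.
apply: indep_systemsC; apply: indep_generatedl => //.
exact: indep_systemsC.
Qed.

End IndependentSystems.

Section GroupingLemma.
Context {dW : measure_display} {W : measurableType dW} {R : realType}.
Context {I : choiceType}.
Variables (Pr : probability W R) (S : I -> set (set W)).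
Hypothesis SI : forall i, setI_closed (S i).
Hypothesis ST : forall i, S i setT.
Hypothesis Sm : forall i, S i `<=` measurable.
Hypothesis indS : mutually_independent Pr S.

(** Finite intersections of events indexed by [J]: a pi-system whose sigma-algebra contains every
    class [S j] with [j] in [J]. The sets [A i] belong to [S i] even off the list, so that two
    families can be merged by a case distinction. *)
Let cylinders (J : set I) : set (set W) :=
  [set C | exists s A, [/\ uniq s, {in s, forall i, J i}, forall i, S i (A i)
    & C = \big[setI/setT]_(i <- s) A i]].

Let cylindersI J : setI_closed (cylinders J).
Proof.
move=> _ _ [s1 [A1 [us1 s1J SA1 ->]]] [s2 [A2 [us2 s2J SA2 ->]]].
exists (undup (s1 ++ s2)), (fun i => (if i \in s1 then A1 i else setT) `&`
  (if i \in s2 then A2 i else setT)); split.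
- exact: undup_uniq.
- by move=> i; rewrite mem_undup mem_cat => /orP[/s1J|/s2J].
- by move=> i; apply: SI; case: ifP.
rewrite -!bigcap_seq; apply/seteqP; split=> [w [w1 w2] i /=|w /= w12].
  rewrite mem_undup mem_cat => _; split.
    by case: ifP => // i1; exact: w1.
  by case: ifP => // i2; exact: w2.
split=> i /= si.
  have [] : ((if i \in s1 then A1 i else setT) `&`
      (if i \in s2 then A2 i else setT)) w.
    by apply: w12; rewrite /= mem_undup mem_cat si.
  by rewrite si.
have [] : ((if i \in s1 then A1 i else setT) `&`
    (if i \in s2 then A2 i else setT)) w.
  by apply: w12; rewrite /= mem_undup mem_cat si orbT.
by rewrite si.
Qed.

Let cylindersT J : cylinders J setT.
Proof. by exists [::], (fun=> setT); split=> //; rewrite big_nil. Qed.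

Let cylinders_measurable J : cylinders J `<=` measurable.
Proof.
move=> _ [s [A [_ _ SA ->]]]; apply: bigsetI_measurable => i _.
exact: Sm (SA i).
Qed.

Let sub_cylinders J :
  <<s \bigcup_(j in J) S j >> `<=` <<s cylinders J >>.
Proof.
apply: sub_sigma_algebra2 => A [j Jj SjA].
exists [:: j], (fun i => if i == j then A else setT); split=> //.
- by move=> i; rewrite inE => /eqP ->.
- by move=> i; case: eqP => [->|].
- by rewrite big_seq1 eqxx.
Qed.

(** Disjointness of [J1] and [J2] makes the concatenation of two index lists free of repetitions, so
    mutual independence factors the intersection of two cylinders; the pi-system argument extends
    this to the generated sigma-algebras. *)
Lemma indep_groups (J1 J2 : set I) : J1 `&` J2 = set0 ->
  indep_systems Pr <<s \bigcup_(j in J1) S j >> <<s \bigcup_(j in J2) S j >>.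
Proof.
move=> J12 A B /sub_cylinders GA /sub_cylinders GB; move: A B GA GB.
apply: indep_generated => //.
move=> _ _ [s1 [A1 [us1 s1J SA1 ->]]] [s2 [A2 [us2 s2J SA2 ->]]].
have s12 i : i \in s2 -> (i \in s1) = false.
  move=> /s2J i2; apply/negP => /s1J i1.
  by have : (J1 `&` J2) i by []; rewrite J12.
pose A i := if i \in s1 then A1 i else A2 i.
have e1 : \big[setI/setT]_(i <- s1) A1 i = \big[setI/setT]_(i <- s1) A i.
  by apply: eq_big_seq => i i1; rewrite /A i1.
have e2 : \big[setI/setT]_(i <- s2) A2 i = \big[setI/setT]_(i <- s2) A i.
  by apply: eq_big_seq => i /s12 i1; rewrite /A i1.
rewrite e1 e2 -big_cat/= !indS//; first by rewrite big_cat.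
- by move=> i _; rewrite /A; case: ifP.
- by move=> i _; rewrite /A; case: ifP.
- rewrite cat_uniq us1 us2 andbT/=; apply/hasPn => i /s12.
  by move=> /= ->.
- by move=> i _; rewrite /A; case: ifP.
Qed.

End GroupingLemma.

Section IndependentElements.
Context {dW d1 d2 : measure_display} {W : measurableType dW}.
Context {T1 : measurableType d1} {T2 : measurableType d2} {R : realType}.
Variables (Pr : probability W R) (Y1 : W -> T1) (Y2 : W -> T2).
Hypotheses (mY1 : measurable_fun setT Y1) (mY2 : measurable_fun setT Y2).
Hypothesis indY : indep_systems Pr (preimage_set_system setT Y1 measurable)
  (preimage_set_system setT Y2 measurable).

Let X1 : {mfun W >-> T1} := HB.pack Y1 (isMeasurableFun.Build _ _ _ _ Y1 mY1).
Let X2 : {mfun W >-> T2} := HB.pack Y2 (isMeasurableFun.Build _ _ _ _ Y2 mY2).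
Let Y12 w := (Y1 w, Y2 w).
Let mY12 : measurable_fun setT Y12.
Proof. exact: measurable_fun_pair. Qed.
Let X12 : {mfun W >-> (T1 * T2)%type} :=
  HB.pack Y12 (isMeasurableFun.Build _ _ _ _ Y12 mY12).

Let lawE (X : set (T1 * T2)) : measurable X ->
  (distribution Pr X1 \x distribution Pr X2)%E X = distribution Pr X12 X.
Proof.
apply: product_measure_unique => A B mA mB.
rewrite /distribution /pushforward /= -indY; last 2 first.
- by exists A => //; rewrite setTI.
- by exists B => //; rewrite setTI.
by congr (Pr _); apply/seteqP.
Qed.

Lemma ge0_integral_indep (Phi : T1 * T2 -> \bar R) :
  measurable_fun setT Phi -> (forall z, 0 <= Phi z)%E ->
  (\int[Pr]_w Phi (Y1 w, Y2 w) = \int[Pr]_w \int[Pr]_w' Phi (Y1 w, Y2 w'))%E.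
Proof.
move=> mPhi Phi0.
transitivity (\int[distribution Pr X12]_z Phi z)%E.
  by rewrite ge0_integral_distribution.
rewrite -(eq_measure_integral _ (fun A mA _ => lawE mA)) fubini_tonelli1//.
rewrite ge0_integral_distribution//; last 2 first.
- exact: measurable_fun_fubini_tonelli_F.
- by move=> y; apply: integral_ge0.
apply: eq_integral => w _; rewrite /= /fubini_F ge0_integral_distribution//.
exact: measurableT_comp.
Qed.

Lemma measurable_integral_indep (Phi : T1 * T2 -> \bar R) :
  measurable_fun setT Phi -> (forall z, 0 <= Phi z)%E ->
  measurable_fun setT (fun y => \int[Pr]_w Phi (y, Y2 w))%E.
Proof.
move=> mPhi Phi0.
rewrite (_ : (fun _ => _) = fubini_F (distribution Pr X2) Phi).
  exact: measurable_fun_fubini_tonelli_F.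
apply/funext => y; rewrite /fubini_F ge0_integral_distribution//.
exact: measurableT_comp.
Qed.

(** Fubini on the product of the two laws. Integrability is asked of every slice, not almost every
    one, so that each inner integral can be carried back from the law of [Y2] to [Pr]. *)
Lemma integral_indep (Phi : T1 * T2 -> \bar R) :
  measurable_fun setT Phi ->
  Pr.-integrable setT (fun w => Phi (Y1 w, Y2 w)) ->
  (forall y, Pr.-integrable setT (fun w => Phi (y, Y2 w))) ->
  (\int[Pr]_w Phi (Y1 w, Y2 w) = \int[Pr]_w \int[Pr]_w' Phi (Y1 w, Y2 w'))%E.
Proof.
move=> mPhi iPhi iPhi2.
have iP : (distribution Pr X1 \x distribution Pr X2)%E.-integrable setT Phi.
  apply/integrableP; split=> //.
  rewrite (eq_measure_integral _ (fun A mA _ => lawE mA)).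
  rewrite ge0_integral_distribution//; last exact: measurableT_comp.
  by case/integrableP: iPhi.
transitivity (\int[distribution Pr X12]_z Phi z)%E.
  by rewrite (integral_distribution _ (X := X12)).
rewrite -(eq_measure_integral _ (fun A mA _ => lawE mA)).
rewrite -integral12_prod_meas1// (integral_distribution _ (X := X1)).
- apply: eq_integral => w _.
  rewrite /= /fubini_F (integral_distribution _ (X := X2))//.
    exact: measurableT_comp.
  exact: iPhi2.
- exact: (measurable_fubini_F iP).
apply/integrableP; split.
  by apply: measurableT_comp => //; exact: (measurable_fubini_F iP).
have := integrable_fubini_F iP => /integrableP[mF].
rewrite ge0_integral_distribution//.
by apply: measurableT_comp => //; exact: (measurable_fubini_F iP).
Qed.

End IndependentElements.

(** Integrability and a real value travel together, so that means add, scale and compare as real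
    numbers without side conditions on infinite values. *)
Definition has_mean (dW : measure_display) (W : measurableType dW)
    (R : realType) (Pr : probability W R) (Y : W -> R) (c : R) : Prop :=
  Pr.-integrable setT (EFin \o Y) /\ (\int[Pr]_w (Y w)%:E)%E = c%:E.

Section Means.
Context {dW : measure_display} {W : measurableType dW} {R : realType}.
Variable Pr : probability W R.
Implicit Types (Y V : W -> R) (a b c : R).

Lemma has_mean_measurable Y c : has_mean Pr Y c -> measurable_fun setT Y.
Proof. by case=> /measurable_int/measurable_EFinP. Qed.

Lemma has_mean_integrable Y : Pr.-integrable setT (EFin \o Y) ->
  has_mean Pr Y (fine (\int[Pr]_w (Y w)%:E)).
Proof. by move=> iY; split=> //; rewrite fineK// integrable_fin_num. Qed.

Lemma has_mean_cst c : has_mean Pr (fun=> c) c.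
Proof.
split; first exact: finite_measure_integrable_cst.
rewrite integral_cst// [X in (_ * X)%E](@probability_setT _ _ _ Pr).
by rewrite mule1.
Qed.

Lemma has_mean_bounded Y B : measurable_fun setT Y ->
  {ae Pr, forall w, `|Y w| <= B} ->
  has_mean Pr Y (fine (\int[Pr]_w (Y w)%:E)).
Proof.
move=> mY YB; apply: has_mean_integrable; apply/integrableP; split.
  exact/measurable_EFinP.
apply: (@le_lt_trans _ _ (\int[Pr]_w `|B%:E|)%E); last first.
  by case/integrableP: (has_mean_cst B).1.
apply: ae_ge0_le_integral => //.
  by apply: measurableT_comp => //; exact/measurable_EFinP.
apply: filterS YB => w YB _ /=.
by rewrite lee_fin (le_trans YB)// ler_norm.
Qed.

Import HBNNSimple.

(* [h] need not be measurable, unlike in [ge0_le_integral]. *)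
Lemma ge0_integral_le_mean (h : W -> \bar R) Y c : (forall w, 0 <= h w)%E ->
  (forall w, h w <= (Y w)%:E)%E -> has_mean Pr Y c ->
  (\int[Pr]_w h w <= c%:E)%E.
Proof.
(* The integral of a nonnegative function is a supremum over the simple functions below it; each of
   these is measurable and stays below [Y]. *)
move=> h0 hY [iY <-]; rewrite ge0_integralTE//.
apply: ge_ereal_sup => _ [s sh <-]; rewrite -integralT_nnsfun.
apply: ge0_le_integral => //.
- by move=> w _; rewrite lee_fin; exact: fun_ge0.
- exact/measurable_EFinP/measurable_funP.
- exact: measurable_int iY.
- by move=> w _; exact: le_trans (sh w) (hY w).
Qed.

Lemma has_meanD Y V a b : has_mean Pr Y a -> has_mean Pr V b ->
  has_mean Pr (fun w => Y w + V w) (a + b).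
Proof.
move=> [iY eY] [iV eV]; split; last first.
  by under eq_integral do rewrite EFinD; rewrite integralD// eY eV.
have := integrableD measurableT iY iV; apply: eq_integrable => // w _.
Qed.

Lemma has_meanZ k Y a : has_mean Pr Y a ->
  has_mean Pr (fun w => k * Y w) (k * a).
Proof.
move=> [iY eY]; split; last first.
  by under eq_integral do rewrite EFinM; rewrite integralZl// eY.
have := integrableZl measurableT k iY; apply: eq_integrable => // w _.
Qed.

Lemma has_mean_sum (I : Type) (s : seq I) (Y : I -> W -> R) (a : I -> R) :
  (forall i, has_mean Pr (Y i) (a i)) ->
  has_mean Pr (fun w => \sum_(i <- s) Y i w) (\sum_(i <- s) a i).
Proof.
move=> Ya; elim: s => [|i s IH].
  rewrite (_ : (fun _ => _) = fun=> 0); last by apply/funext => w; rewrite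
      big_nil.
  by rewrite big_nil; exact: has_mean_cst.
rewrite (_ : (fun _ => _) = fun w => Y i w + \sum_(j <- s) Y j w).
  by rewrite big_cons; exact: has_meanD.
by apply/funext => w; rewrite big_cons.
Qed.

Lemma has_mean_le Y V a b : has_mean Pr Y a -> has_mean Pr V b ->
  (forall w, Y w <= V w) -> a <= b.
Proof.
move=> [iY eY] [iV eV] YV; rewrite -lee_fin -eY -eV.
by apply: le_integral => // w _; rewrite lee_fin.
Qed.

Lemma has_mean_ae Y V a : measurable_fun setT V ->
  {ae Pr, forall w, Y w = V w} -> has_mean Pr Y a -> has_mean Pr V a.
Proof.
move=> mV YV [iY eY]; have mY := has_mean_measurable (conj iY eY).
have eYV g : measurable_fun setT g ->
    (\int[Pr]_w g (V w)%:E = \int[Pr]_w g (Y w)%:E)%E.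
  move=> mg; apply: ae_eq_integral => //.
  - by apply: measurableT_comp => //; exact/measurable_EFinP.
  - by apply: measurableT_comp => //; exact/measurable_EFinP.
  - by apply: filterS YV => w /= -> _.
split; last by rewrite -eY; apply: (eYV id).
apply/integrableP; split; first exact/measurable_EFinP.
by rewrite (eYV abse)//; case/integrableP: iY.
Qed.

Lemma has_mean_comp (dT : measure_display) (T : measurableType dT)
    (Q : probability T R) (Y : W -> T) (h : T -> R) a :
  has_law Pr Y Q -> has_mean Q h a -> has_mean Pr (h \o Y) a.
Proof.
move=> [mY lawY] [ih eh]; have mh := measurable_int _ ih.
pose X : {mfun W >-> T} := HB.pack Y (isMeasurableFun.Build _ _ _ _ Y mY).
have eX g : (\int[Q]_t g t = \int[distribution Pr X]_t g t)%E.
  by apply: eq_measure_integral => A mA _; exact/esym/lawY.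
have iX : Pr.-integrable setT ((EFin \o h) \o Y).
  apply/integrableP; split; first exact: measurableT_comp.
  case/integrableP : ih => _; rewrite eX ge0_integral_distribution//.
  exact: measurableT_comp.
split=> //.
by rewrite -eh eX (integral_distribution _ (X := X)).
Qed.

(** Integrability of the product comes first, from Tonelli applied to its absolute value, whose
    double integral factors; Fubini then gives the value. *)
Lemma has_meanM Y V a b :
  indep_systems Pr (preimage_set_system setT Y measurable)
    (preimage_set_system setT V measurable) ->
  has_mean Pr Y a -> has_mean Pr V b ->
  has_mean Pr (fun w => Y w * V w) (a * b).
Proof.
move=> YV [iY eY] [iV eV].
have mY := has_mean_measurable (conj iY eY).
have mV := has_mean_measurable (conj iV eV).
have mM : measurable_fun setT (fun z : R * R => (z.1 * z.2)%:E).
  by apply/measurable_EFinP; apply: measurable_funM.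
have iV' y : Pr.-integrable setT (fun w => (y * V w)%:E).
  exact: (has_meanZ y (conj iV eV)).1.
have iYV : Pr.-integrable setT (fun w => (Y w * V w)%:E).
  apply/integrableP; split.
    by apply/measurable_EFinP; exact: measurable_funM.
  rewrite (ge0_integral_indep mY mV YV (Phi := fun z => `|(z.1 * z.2)%:E|%E))//;
    last exact: measurableT_comp.
  under eq_integral => w _.
    under eq_integral => w' _ do rewrite /= normrM EFinM.
    rewrite ge0_integralZl//; last by do 2 apply: measurableT_comp => //.
    over.
  rewrite ge0_integralZr//.
  - by rewrite lte_mul_pinfty//; [exact: integral_ge0| |];
      [apply: integrable_fin_num => //; exact: integrable_norm|
       case/integrableP: iV].
  - by do 2 apply: measurableT_comp => //.
  - exact: integral_ge0.
split=> //.
rewrite (integral_indep mY mV YV (Phi := fun z => (z.1 * z.2)%:E))//.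
under eq_integral => w _ do
  rewrite (has_meanZ (Y w) (conj iV eV)).2 mulrC.
by rewrite (has_meanZ b (conj iY eY)).2 mulrC.
Qed.

End Means.

(** * The uniform distribution on a sphere *)

Section Orthogonal.
Context {R : realType} {d : nat}.
Implicit Types (a b z : 'rV[R]_d) (Q : 'M[R]_d).

Lemma dotpE a b : dotp a b = (a *m b^T) 0 0.
Proof. by rewrite mxE; apply: eq_bigr => i _; rewrite mxE. Qed.

Lemma dotp_mulmxr a b Q : dotp a (b *m Q) = dotp (a *m Q^T) b.
Proof. by rewrite !dotpE trmx_mul mulmxA. Qed.

Lemma dotp_orthogonal a b Q : Q *m Q^T = 1%:M ->
  dotp (a *m Q) (b *m Q) = dotp a b.
Proof. by move=> Q1; rewrite !dotpE trmx_mul mulmxA -(mulmxA a) Q1 mulmx1. Qed.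

Lemma l2norm_orthogonal a Q : Q *m Q^T = 1%:M -> l2norm (a *m Q) = l2norm a.
Proof. by move=> Q1; rewrite /l2norm dotp_orthogonal. Qed.

(* The witness is the Householder reflection exchanging [a] and [b]. *)
Lemma orthogonal_transitive a b : dotp a a = dotp b b ->
  exists2 Q, Q *m Q^T = 1%:M & a *m Q = b.
Proof.
move=> ab; have [->|nab] := eqVneq a b.
  by exists 1%:M; rewrite ?trmx1 ?mulmx1.
(* The reflection across the hyperplane orthogonal to [v], which is nonzero because [a] and [b]
   differ. *)
pose v := a - b; pose c := 2 / dotp v v.
have vv0 : dotp v v != 0.
  apply: contra nab => /eqP vv; apply/eqP/subr0_eq/l2norm_eq0.
  by apply/eqP; rewrite -sqrf_eq0 sqr_l2norm vv.
have vvT : v *m v^T = (dotp v v)%:M by rewrite dotpE -mx11_scalar.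
pose P := v^T *m v.
have PP : P *m P = dotp v v *: P.
  by rewrite /P mulmxA -(mulmxA v^T) vvT mul_mx_scalar -scalemxAl.
pose Q := 1%:M - c *: P.
have QT : Q^T = Q by rewrite /Q linearB linearZ/= trmx1 trmx_mul trmxK.
have cE : c * c * dotp v v = c + c by rewrite /c; field.
exists Q.
  rewrite QT /Q mulmxBr mulmx1 mulmxBl mul1mx -scalemxAl -scalemxAr PP !scalerA.
  rewrite cE scalerDl; set B := c *: P.
  by rewrite (_ : B - (B + B) = - B) ?opprK ?subrK// opprD addrA subrr add0r.
rewrite /Q mulmxBr mulmx1 -scalemxAr mulmxA.
have -> : a *m v^T = (dotp a v)%:M by rewrite dotpE -mx11_scalar.
rewrite mul_scalar_mx scalerA.
(* Equal norms give [dotp v v = 2 * dotp a v], so the reflection subtracts exactly [v] from [a]. *)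
have -> : c * dotp a v = 1.
  rewrite /c; have : dotp v v = 2 * dotp a v.
    by rewrite /v dotpBl !dotpBr (dotpC b a) -ab; ring.
  move=> e; rewrite e; field; by move: vv0; rewrite e mulf_eq0 pnatr_eq0.
by rewrite scale1r opprB addrC subrK.
Qed.

Lemma open_preimage_orthogonal Q (U : set 'rV[R]_d) : Q *m Q^T = 1%:M ->
  open U -> open ((fun z => z *m Q) @^-1` U).
Proof.
move=> Q1 oU; rewrite openE => z Uz.
have [e e0 eU] := open_l2ball_sub oU Uz.
have : nbhs z [set y | l2norm (y - z) < e].
  apply: open_nbhs_nbhs; split; first exact: open_l2ball.
  by rewrite /= subrr l2norm0.
apply: filterS => y /= yz; apply: eU => /=.
by rewrite -mulmxBl l2norm_orthogonal.
Qed.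

Lemma measurable_mulmx_orthogonal Q : Q *m Q^T = 1%:M ->
  measurable_fun setT (fun z : 'rV[R]_d => z *m Q).
Proof.
move=> Q1; apply: (@measurability _ _ _ _ _ _ (@open 'rV[R]_d)) => //.
move=> _ [U oU <-]; rewrite setTI.
by apply: measurable_rV_open; exact: open_preimage_orthogonal.
Qed.

End Orthogonal.

Lemma negligible_bigsetU_seq (d : measure_display) (T : measurableType d)
    (R : realType) (mu : {measure set T -> \bar R}) (I : Type) (s : seq I)
    (F : I -> set T) :
  (forall i, mu.-negligible (F i)) ->
  mu.-negligible (\big[setU/set0]_(i <- s) F i).
Proof.
move=> F0; elim: s => [|i s IH]; first by rewrite big_nil; exact:
    negligible_set0.
by rewrite big_cons; exact: negligibleU.
Qed.

Section UniformOnSphere.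
Context {R : realType} {d : nat}.
Variables (mu : probability 'rV[R]_d R) (r : R).
Hypothesis mu_unif : uniform_on_sphere mu r.
Let sphere : set 'rV[R]_d := [set z | l2norm z = r].

Let closed_sphere : closed sphere.
Proof.
rewrite (_ : sphere = @l2norm R d @^-1` [set r])//.
apply: closed_comp => [z _|]; [exact: l2norm_continuous|exact: closed_eq].
Qed.

Let measurable_sphere : measurable sphere.
Proof.
rewrite -[sphere]setCK; apply: measurableC; apply: measurable_rV_open.
exact: closed_openC.
Qed.

Lemma uniform_on_sphere_ae : {ae mu, forall z, l2norm z = r}.
Proof.
exists (~` sphere); split => //; first exact: measurableC.
rewrite probability_setC//.
have -> : mu sphere = 1%E by case: mu_unif.
by rewrite subee.
Qed.

Let compact_sphere : compact sphere.
Proof.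
have cK : compact [set v : 'rV[R]_d | forall i, v ord0 i \in `[- r, r]].
  apply: (@rV_compact _ _ (fun=> `[- r, r]%classic)) => i.
  exact: segment_compact.
apply: subclosed_compact closed_sphere cK _ => z zr i.
rewrite in_itv/= -ler_norml -[leRHS]zr; exact: coord_le_l2norm.
Qed.

Let orthogonal_law Q : Q *m Q^T = 1%:M -> has_law mu (fun z => z *m Q) mu.
Proof.
move=> Q1; split; first exact: measurable_mulmx_orthogonal.
by case: mu_unif => _; apply.
Qed.

(** If an open set [U] around [z] were null, so would be its preimages under orthogonal maps. These
    cover the sphere, finitely many suffice by compactness, and the sphere itself would be null.
    This turns the domain assumption on the support of [mu] into one on the whole sphere. *)
Lemma msupport_sphere z : l2norm z = r -> msupport mu z.
Proof.
move=> zr U oU Uz; rewrite lt0e measure_ge0 andbT; apply/negP => /eqP U0.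
(* Off the sphere the identity is taken, so that a matrix is chosen for every [a] and [V] is a total
   family. *)
have Qz (a : 'rV[R]_d) : exists Q : 'M[R]_d,
    Q *m Q^T = 1%:M /\ (l2norm a = r -> a *m Q = z).
  have [ar|nar] := eqVneq (l2norm a) r; last first.
    exists 1%:M; rewrite trmx1 mulmx1; split=> // /eqP.
    by rewrite (negbTE nar).
  have [|Q Q1 Qa] := @orthogonal_transitive R d a z; last by exists Q.
  by rewrite -!sqr_l2norm ar zr.
pose V a := (fun y => y *m sval (cid (Qz a))) @^-1` U.
have V0 a : mu.-negligible (V a).
  have [Q1 _] := svalP (cid (Qz a)).
  exists (V a); split=> //.
    by apply: measurable_rV_open; exact: open_preimage_orthogonal.
  rewrite /V (proj2 (orthogonal_law Q1)) ?U0//; exact: measurable_rV_open.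
have := compact_sphere; rewrite compact_cover => /(_ _ setT V).
case.
- by move=> a _; apply: open_preimage_orthogonal => //; case: (svalP (cid (Qz
    a))).
- move=> a ar; exists a => //; rewrite /V /=.
  by have [_ ->] := svalP (cid (Qz a)).
move=> D _ DK.
have : mu.-negligible sphere.
  have := negligible_bigsetU_seq (finmap.enum_fset D) V0; apply: negligibleS.
  by move=> a /DK [i /= iD Via]; rewrite -bigcup_seq; exists i.
move=> /(negligibleP mu measurable_sphere) s0.
have [s1 _] := mu_unif; have : (1 = 0 :> \bar R)%E by rewrite -s1 -s0.
by move/eqP; rewrite onee_eq0.
Qed.

Let m2 a b := fine (\int[mu]_z (dotp a z * dotp b z)%:E).

Let has_m2 a b : has_mean mu (fun z => dotp a z * dotp b z) (m2 a b).
Proof.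
apply: (has_mean_bounded (B := l2norm a * r * (l2norm b * r))).
  apply: measurable_funM; apply: measurable_dotp => //; exact: measurable_cst.
apply: filterS uniform_on_sphere_ae => z zr; rewrite normrM ler_pM//.
  by rewrite (le_trans (abs_dotp_le _ _))// zr.
by rewrite (le_trans (abs_dotp_le _ _))// zr.
Qed.

Let has_mean_unique h a b : has_mean mu h a -> has_mean mu h b -> a = b.
Proof. by move=> [_ ea] [_ eb]; apply: EFin_inj; rewrite -ea -eb. Qed.

(** Applying the transpose of [Q] to the sample keeps its law and, inside the inner product, moves
    [Q] onto [a]. *)
Let m2_orthogonal a b : dotp a a = dotp b b -> m2 a a = m2 b b.
Proof.
move=> ab; have [Q Q1 <-] := orthogonal_transitive ab.
have QT1 : Q^T *m Q^T^T = 1%:M by rewrite trmxK mulmx1C.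
have := has_mean_comp (orthogonal_law QT1) (has_m2 a a).
rewrite (_ : _ \o _ = fun z => dotp (a *m Q) z * dotp (a *m Q) z); last first.
  by apply/funext => z; rewrite /= !dotp_mulmxr trmxK.
by move/has_mean_unique; apply; exact: has_m2.
Qed.

Let e i : 'rV[R]_d := delta_mx 0 i.

Let dotp_e i z : dotp (e i) z = z 0 i.
Proof.
rewrite /dotp (bigD1 i)//= big1 ?addr0 => [|j ji]; rewrite mxE eqxx ?eqxx
    ?mul1r//.
by rewrite (negbTE ji) mul0r.
Qed.

Let dotp_ee i j : dotp (e i) (e j) = (i == j)%:R.
Proof. by rewrite dotp_e mxE eqxx. Qed.

(* Rotation invariance makes [E <a, Z>^2] depend on the norm of [a] only:
   comparing the coordinate vectors, and [e_i + e_j] with [e_i - e_j], gives a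
   scalar covariance, whose trace is [r^2]. *)
Lemma uniform_on_sphere_covariance (i j : 'I_d) :
  has_mean mu (fun z => z 0 i * z 0 j) ((i == j)%:R * (r ^+ 2 / d%:R)).
Proof.
have hij k l : has_mean mu (fun z => z 0 k * z 0 l) (m2 (e k) (e l)).
  have := has_m2 (e k) (e l); congr has_mean.
  by apply/funext => z; rewrite !dotp_e.
suff <- : m2 (e i) (e j) = (i == j)%:R * (r ^+ 2 / d%:R) by exact: hij.
have [<-|nij] := eqVneq i j; rewrite ?mul0r ?mul1r.
  have : \sum_k m2 (e k) (e k) = r ^+ 2.
    have := has_mean_sum (index_enum 'I_d) (fun k => hij k k).
    move/has_mean_unique; apply.
    apply: has_mean_ae (has_mean_cst mu (r ^+ 2)).
      apply: measurable_sum => k; apply: measurable_funM; exact: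
          measurable_coord.
    by apply: filterS uniform_on_sphere_ae => z <-; rewrite sqr_l2norm.
  rewrite (eq_bigr (fun=> m2 (e i) (e i))) => [|k _]; last first.
    by apply: m2_orthogonal; rewrite !dotp_ee !eqxx.
  rewrite sumr_const card_ord => <-; rewrite -[X in _ = X / _]mulr_natr mulfK//.
  by rewrite pnatr_eq0 -lt0n (leq_trans _ (ltn_ord i)).
have eij : m2 (e i + e j) (e i + e j) = m2 (e i - e j) (e i - e j).
  apply: m2_orthogonal; rewrite !(dotpDl, dotpDr, dotpNl, dotpNr) !dotp_ee.
  by rewrite !eqxx (negbTE nij) (eq_sym j) (negbTE nij) /=; ring.
have := has_m2 (e i + e j) (e i + e j).
have := has_meanD (has_m2 (e i - e j) (e i - e j)) (has_meanZ 4 (hij i j)).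
set h := (X in has_mean _ X _ -> _); set h' := (X in _ -> has_mean _ X _ -> _).
have -> : h = h'.
  apply/funext => z; rewrite /h /h' !(dotpDl, dotpNl) !dotp_e; ring.
move=> /has_mean_unique h1 /h1; rewrite eij => h2.
have : 4 * m2 (e i) (e j) = 0 by move: h2; lra.
by move/eqP; rewrite mulf_eq0 pnatr_eq0/= => /eqP.
Qed.

End UniformOnSphere.

(** * Convex functions with a Lipschitz gradient *)

Lemma convex_set_comb (R : numDomainType) (M : lmodType R)
    (A : set (convex_lmodType M)) (x y : M) (s : R) :
  convex_set A -> A x -> A y -> 0 <= s -> s <= 1 ->
  A (s *: x + (1 - s) *: y : M).
Proof.
move=> cA Ax Ay s0 s1.
by have := cA x y (Itv01 s0 s1); rewrite !inE; apply.
Qed.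

Section DirectionalDerivative.
Context {R : realType} {d : nat}.
Implicit Types (h : 'rV[R]_d -> R^o) (x y v : 'rV[R]_d).

(** The difference quotient has a two-sided limit, so bounding it for small positive [t] is enough;
    convexity supplies bounds on that side. *)
Lemma derive_le h x v (c t0 : R) : differentiable h x -> 0 < t0 ->
  (forall t, 0 < t -> t < t0 -> h (x + t *: v) - h x <= t * c) ->
  'D_v h x <= c.
Proof.
move=> dh t00 hc; have := @diff_derivable _ _ _ h x v dh.
move=> /cvg_dnbhs_at_right /cvgr_to_le; apply.
near=> t; have t0' : 0 < t by near: t; exact: nbhs_right_gt.
rewrite /= ler_pdivrMl//.
by rewrite (addrC _ x); apply: hc => //; near: t; exact: nbhs_right_lt.
Unshelve. all: by end_near. Qed.

Lemma derive_ge h x v (c t0 : R) : differentiable h x -> 0 < t0 ->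
  (forall t, 0 < t -> t < t0 -> t * c <= h (x + t *: v) - h x) ->
  c <= 'D_v h x.
Proof.
move=> dh t00 hc; have := @diff_derivable _ _ _ h x v dh.
move=> /cvg_dnbhs_at_right /cvgr_to_ge; apply.
near=> t; have t0' : 0 < t by near: t; exact: nbhs_right_gt.
rewrite /= ler_pdivlMl//.
by rewrite (addrC _ x); apply: hc => //; near: t; exact: nbhs_right_lt.
Unshelve. all: by end_near. Qed.

Lemma derive_dotp h x v : differentiable h x ->
  'D_v h x = dotp (gradient h x) v.
Proof.
move=> dh; rewrite deriveE// [in LHS](row_sum_delta v) linear_sum.
by apply: eq_bigr => i _; rewrite linearZ/= mxE deriveE// mulrC.
Qed.

End DirectionalDerivative.

Section ConvexSmooth.
Context {R : realType} {d : nat}.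
Variables (phi : 'rV[R]_d -> \bar R) (L : R).
Hypotheses (cphi : closed_convex_fun phi) (Lphi : lipschitz_gradient phi L).
Implicit Types (x y z v w : 'rV[R]_d).

Let h : 'rV[R]_d -> R^o := fun x => fine (phi x).

Lemma edom_fine x : edom phi x -> phi x = (fine (phi x))%:E.
Proof.
case: cphi => phiNoo _ _ xoo; rewrite fineK// fin_numE phiNoo/=.
by rewrite lt_eqF.
Qed.

Lemma convex_comb_le x y s : edom phi x -> edom phi y -> 0 <= s -> s <= 1 ->
  (phi (s *: x + (1 - s) *: y)%R <= (s * h x + (1 - s) * h y)%:E)%E.
Proof.
move=> dx dy s0 s1; case: cphi => _ _ cE.
have := @convex_set_comb _ _ _ (x, h x : R^o) (y, h y : R^o) s cE.
by apply => //=; rewrite /epigraph /= -edom_fine.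
Qed.

Lemma edom_comb x y s : edom phi x -> edom phi y -> 0 <= s -> s <= 1 ->
  edom phi (s *: x + (1 - s) *: y).
Proof.
by move=> dx dy s0 s1; apply: le_lt_trans (convex_comb_le dx dy s0 s1) (ltry _).
Qed.

Lemma fine_comb_le x y s : edom phi x -> edom phi y -> 0 <= s -> s <= 1 ->
  h (s *: x + (1 - s) *: y) <= s * h x + (1 - s) * h y.
Proof.
move=> dx dy s0 s1; rewrite -lee_fin -edom_fine; last exact: edom_comb.
exact: convex_comb_le.
Qed.

Lemma gradient_subgradient x y : (edom phi)° x -> edom phi y ->
  dotp (gradient h x) (y - x) <= h y - h x.
Proof.
move=> ix dy; have dx := interior_subset ix.
rewrite -derive_dotp; last exact: (proj1 Lphi).
apply: (@derive_le _ _ _ _ _ _ 1) => // [|t t0 t1]; first exact: (proj1 Lphi).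
have -> : x + t *: (y - x) = t *: y + (1 - t) *: x.
  by rewrite scalerBr scalerBl scale1r addrCA.
by have := fine_comb_le dy dx (ltW t0) (ltW t1); lra.
Qed.

(** The one-sided quotients of [h] in a direction [w] dominate [dotp v w], so [v] minus the gradient
    pairs nonpositively with every [w], in particular with itself. The Lipschitz bound on gradients
    thereby applies to the selected subgradient. *)
Lemma subgradient_gradient x v : (edom phi)° x -> subdifferential phi x v ->
  gradient h x = v.
Proof.
move=> ix [_ sv]; have dx := interior_subset ix.
have [e e0 ex] : exists2 e : R, 0 < e & [set y | l2norm (y - x) < e] `<=` edom
    phi.
  have [] := open_l2ball_sub (@open_interior _ (edom phi)) ix.
  by move=> e e0 ee; exists e => //; apply: subset_trans ee _; exact:
      interior_subset.
suff H w : dotp (v - gradient h x) w <= 0.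
  apply/esym/subr0_eq/l2norm_eq0; apply/eqP.
  by rewrite -sqrf_eq0 sqr_l2norm eq_le H dotp_ge0.
rewrite dotpBl subr_le0 -derive_dotp; last exact: (proj1 Lphi).
(* The added 1 keeps the divisor of the step bound [e / (l2norm w + 1)] positive when [w] is
   zero. *)
have w0 : 0 < l2norm w + 1 by rewrite ltr_wpDl ?l2norm_ge0.
apply: (@derive_ge _ _ _ _ _ _ (e / (l2norm w + 1))) => [||t t0 te].
- exact: (proj1 Lphi).
- by rewrite divr_gt0.
have xt : edom phi (x + t *: w).
  apply: ex; rewrite /= addrC addKr l2normZ gtr0_norm//.
  rewrite (le_lt_trans (_ : _ <= t * (l2norm w + 1)))//.
    by rewrite ler_pM2l// lerDl.
  by rewrite -ltr_pdivlMr.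
have := sv (x + t *: w); rewrite (edom_fine dx) (edom_fine xt) -EFinD lee_fin.
by rewrite addrAC subrr add0r dotpZr => ?; rewrite lerBrDl.
Qed.

(* Each bound only uses the value of the gradient at one point: the lower one
   is the subgradient inequality at [x], the upper one that at [x + s u z] for
   [s < 1], which is interior to the domain even when [x + u z] is not. *)
Lemma finite_difference_bounds x v z (rho u1 u : R) :
  0 < rho -> 0 <= L -> 0 < u -> u <= u1 ->
  (forall y, l2norm y = rho -> edom phi (x + u1 *: y)) ->
  subdifferential phi x v -> l2norm z = rho ->
  0 <= h (x + u *: z) - h x - u * dotp v z <= u ^+ 2 * L * rho ^+ 2.
Proof.
move=> rho0 L0 u0 uu1 dom sv zrho.
have u10 : 0 < u1 by exact: lt_le_trans uu1.
(* The assumption covers only a sphere around [x]. A point [x + c *: e] of the ball lies on the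
   chord between the antipodal points [x + u1 *: e] and [x - u1 *: e], with weight
   [(1 + c / u1) / 2]; at the centre the direction is arbitrary and [z] serves. *)
have ball_dom y : l2norm (y - x) <= u1 * rho -> edom phi y.
  move=> yx; have [e zE ue] : exists2 e, l2norm e = rho &
      exists2 c : R, y - x = c *: e & `|c| <= u1.
    have [yx0|yx0] := eqVneq (l2norm (y - x)) 0.
      exists z => //; exists 0; rewrite ?normr0 ?(ltW u10)//.
      by rewrite scale0r (l2norm_eq0 yx0).
    have yx1 : 0 < l2norm (y - x) by rewrite lt0r yx0 l2norm_ge0.
    exists ((rho / l2norm (y - x)) *: (y - x)).
      by rewrite l2normZ gtr0_norm ?divr_gt0// divfK.
    exists (l2norm (y - x) / rho).
      by rewrite scalerA mulrA divfK ?gt_eqF// divff// scale1r.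
    by rewrite gtr0_norm ?divr_gt0// ler_pdivrMr.
  case: ue => c yc cu1.
  have dp := dom e zE; have dm : edom phi (x + u1 *: - e).
    by apply: dom; rewrite l2normN.
  have c1 : `|c / u1| <= 1 by rewrite normrM normfV (gtr0_norm u10)
      ler_pdivrMr// mul1r.
  have := edom_comb (s := (1 + c / u1) / 2) dp dm.
  have -> : ((1 + c / u1) / 2) *: (x + u1 *: e) +
      (1 - (1 + c / u1) / 2) *: (x + u1 *: - e) = y.
    have -> : y = x + c *: e by rewrite -yc addrC subrK.
    by apply/rowP => i; rewrite !mxE; field; rewrite gt_eqF.
  by move: c1; rewrite ler_norml => /andP[c1 c2]; apply; lra.
have intx y : l2norm (y - x) < u1 * rho -> (edom phi)° y.
  move=> yx; have : nbhs y [set y' | l2norm (y' - x) < u1 * rho].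
    by apply: open_nbhs_nbhs; split => //; exact: open_l2ball.
  by apply: filterS => y' /= /ltW; exact: ball_dom.
have ix : (edom phi)° x by apply: intx; rewrite subrr l2norm0 mulr_gt0.
have dx := interior_subset ix.
have gx := subgradient_gradient ix sv.
have du : edom phi (x + u *: z).
  by apply: ball_dom; rewrite addrC addKr l2normZ gtr0_norm// zrho ler_pM2r.
apply/andP; split.
  case: sv => _ /(_ (x + u *: z)).
  rewrite (edom_fine dx) (edom_fine du) -EFinD lee_fin.
  by rewrite addrAC subrr add0r dotpZr /h; lra.
have upper s : 0 < s -> s < 1 -> h (x + (s * u) *: z) <=
    h x + s * (u * dotp v z) + s * (u ^+ 2 * L * rho ^+ 2).
  move=> s0 s1; set y := x + (s * u) *: z.
  have yx : y - x = (s * u) *: z by rewrite /y addrC addKr.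
  have su0 : 0 < s * u by rewrite mulr_gt0.
  have iy : (edom phi)° y.
    apply: intx; rewrite yx l2normZ gtr0_norm// zrho ltr_pM2r//.
    by rewrite (lt_le_trans _ uu1)// gtr_pMl.
  have := gradient_subgradient iy dx.
  rewrite -(opprB y) yx dotpNr dotpZr => gy.
  have := (proj2 Lphi) _ _ iy ix; rewrite -/h gx yx l2normZ (gtr0_norm su0)
      zrho => gLip.
  have := dotp_le_l2norm (gradient h y - v) z; rewrite dotpBl zrho => gz.
  have : (l2norm (gradient h y - v)) * rho <= L * (s * u * rho) * rho.
    by rewrite ler_pM2r.
  move=> gL; have {gz}gz := le_trans gz gL.
  have : s * u * (dotp (gradient h y) z - dotp v z) <=
      s * u * (L * (s * u * rho) * rho) by rewrite ler_pM2l.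
  have : s * (s * (u ^+ 2 * L * rho ^+ 2)) <= s * (u ^+ 2 * L * rho ^+ 2).
    by rewrite ler_pM2l// ler_piMl ?(ltW s1)// mulr_ge0 ?sqr_ge0// mulr_ge0
        ?sqr_ge0.
  by move: gy; lra.
(* When [u = u1] the endpoint may be on the boundary of the domain, where gradients are not
   controlled. The path [pt] stays in the epigraph for [0 < s < 1], and closedness of the epigraph
   carries the bound to [s = 1]. *)
pose c1 := u * dotp v z + u ^+ 2 * L * rho ^+ 2.
pose pt (s : R) : 'rV[R]_d * R^o := (x + (s * u) *: z, h x + s * c1).
have cpt : continuous pt.
  move=> s; have cu : (t * u) @[t --> s] --> s * u by exact: (cvgMr_tmp cvg_id).
  have cc : (t * c1) @[t --> s] --> s * c1 by exact: (cvgMr_tmp cvg_id).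
  exact: (cvg_pair (cvgD (cvg_cst x) (cvgZr_tmp cu)) (cvgD (cvg_cst (h x)) cc)).
have [_ clE _] := cphi.
have : epigraph phi (pt 1).
  have cl1 : pt s @[s --> 1^'-] --> pt 1 by apply: cvg_at_left_filter; exact:
      cpt.
  refine (@closed_cvg _ _ _ _ pt (epigraph phi) clE _ (pt 1) cl1).
  near=> s.
  have s0 : 0 < s by near: s; exact: nbhs_left_gt.
  have s1 : s < 1 by near: s; exact: nbhs_left_lt.
  rewrite /epigraph /pt /=.
  have ds : edom phi (x + (s * u) *: z).
    apply: ball_dom; rewrite addrC addKr l2normZ gtr0_norm ?mulr_gt0// zrho.
    by rewrite ler_pM2r// (le_trans _ uu1)// ger_pMl// ltW.
  by rewrite (edom_fine ds) lee_fin; have := upper s s0 s1; rewrite /c1 -/(h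
      _); lra.
rewrite /epigraph /pt /= !mul1r (edom_fine du) lee_fin /c1 -/(h _); lra.
Unshelve. all: by end_near. Qed.

End ConvexSmooth.

(** * Moments of the linearized estimate *)

Lemma indep_systemsS (dW : measure_display) (W : measurableType dW)
    (R : realType) (Pr : probability W R) (G G' H H' : set (set W)) :
  G' `<=` G -> H' `<=` H -> indep_systems Pr G H -> indep_systems Pr G' H'.
Proof. by move=> GG HH GH A B /GG GA /HH HB; exact: GH. Qed.

Lemma sigma_of_comp (W : Type) (d1 d2 : measure_display)
    (T1 : measurableType d1) (T2 : measurableType d2) (Y : W -> T1)
    (h : T1 -> T2) : measurable_fun setT h -> sigma_of (h \o Y) `<=` sigma_of Y.
Proof.
move=> mh _ [B mB <-]; exists (h @^-1` B) => //.
by rewrite -[X in measurable X]setTI; exact: mh.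
Qed.

Lemma sigma_of_generated (W : pointedType) (d : measure_display)
    (T : measurableType d) (G : set (set W)) (Y : W -> T) :
  measurable_fun (setT : set (g_sigma_algebraType G)) Y ->
  sigma_of Y `<=` <<s G >>.
Proof. by move=> mY _ [B mB <-]; exact: mY. Qed.

Section MeanOfSquareIntegrable.
Context {dT : measure_display} {T : measurableType dT} {R : realType} {d : nat}.
Variables (P : probability T R) (v : T -> 'rV[R]_d).
Hypotheses (mv : measurable_fun setT v)
  (iv : ('E_P[(fun x => l2norm (v x) ^+ 2)%R] < +oo)%E).

Let mvi i : measurable_fun setT (fun x => v x 0 i).
Proof. exact: (measurableT_comp (measurable_coord i) mv). Qed.

Lemma has_mean_sqr_l2norm : has_mean P (fun x => l2norm (v x) ^+ 2)
  (fine 'E_P[(fun x => l2norm (v x) ^+ 2)%R]).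
Proof.
rewrite unlock; apply: has_mean_integrable; apply/integrableP; split.
  apply/measurable_EFinP; apply: measurable_funX.
  exact: (measurableT_comp measurable_l2norm mv).
move: iv; rewrite unlock; congr (_ < _)%E; apply: eq_integral => x _.
by rewrite /= ger0_norm// sqr_ge0.
Qed.

Let has_mean_dominated (h : T -> R) (c : R) : measurable_fun setT h ->
  (forall x, `|h x| <= c + l2norm (v x) ^+ 2) ->
  has_mean P h (fine (\int[P]_x (h x)%:E)).
Proof.
move=> mh hv; apply: has_mean_integrable.
have [ib _] := has_meanD (has_mean_cst P c) has_mean_sqr_l2norm.
apply: le_integrable ib => //; first exact/measurable_EFinP.
by move=> x _; rewrite /= lee_fin (le_trans (hv x))// ler_norm.
Qed.

Lemma has_mean_coord i :
  has_mean P (fun x => v x 0 i) (fine 'E_P[(fun x => v x 0 i)%R]).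
Proof.
rewrite unlock; apply: (@has_mean_dominated _ 1) => // x.
have := coord_le_l2norm (v x) i; set y := `|_|; set z := l2norm _ => yz.
have : 0 <= (z - 1) ^+ 2 by exact: sqr_ge0.
have : 0 <= z ^+ 2 by exact: sqr_ge0.
by rewrite sqrrB1; nra.
Qed.

Lemma has_mean_coord2 i j : has_mean P (fun x => v x 0 i * v x 0 j)
  (fine (\int[P]_x (v x 0 i * v x 0 j)%:E)).
Proof.
apply: (@has_mean_dominated _ 0) => [|x]; first exact: measurable_funM.
rewrite add0r normrM expr2 ler_pM//; exact: coord_le_l2norm.
Qed.

Lemma sum_mean_coord2 :
  \sum_i fine (\int[P]_x (v x 0 i * v x 0 i)%:E) =
  fine 'E_P[(fun x => l2norm (v x) ^+ 2)%R].
Proof.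
have [_ e1] := has_mean_sqr_l2norm.
have [_ e2] := has_mean_sum (index_enum 'I_d) (fun i => has_mean_coord2 i i).
apply: EFin_inj; rewrite -e1 -e2; apply: eq_integral => x _.
by rewrite sqr_l2norm.
Qed.

End MeanOfSquareIntegrable.

Section LinearizedEstimate.
Context {dW dT : measure_display} {W : measurableType dW}.
Context {T : measurableType dT} {R : realType} {d m : nat}.
Variables (Pr : probability W R) (P : probability T R).
Variables (mu : probability 'rV[R]_d R).
Variables (X : W -> T) (Z : 'I_m -> W -> 'rV[R]_d) (v : T -> 'rV[R]_d).
Hypotheses (d0 : (0 < d)%N) (m0 : (0 < m)%N).
Hypotheses (lawX : has_law Pr X P) (lawZ : forall i, has_law Pr (Z i) mu).
Hypothesis mu_unif : uniform_on_sphere mu (Num.sqrt d%:R).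
Let SZ := \bigcup_i sigma_of (Z i).
Hypothesis XZ : indep_systems Pr (sigma_of X) <<s SZ >>.
Hypothesis ZZ : forall i j, i != j ->
  indep_systems Pr (sigma_of (Z i)) (sigma_of (Z j)).
Hypotheses (mv : measurable_fun setT v)
  (iv : ('E_P[(fun x => l2norm (v x) ^+ 2)%R] < +oo)%E).

Definition linearized_estimate w : 'rV[R]_d :=
  m%:R^-1 *: \sum_i dotp (v (X w)) (Z i w) *: Z i w.

Let G w b : R := v (X w) 0 b.
Let gam b b' := fine (\int[P]_x (v x 0 b * v x 0 b')%:E).
Let del (b c : 'I_d) : R := (b == c)%:R.

Let dpos : 0 < d%:R :> R. Proof. by rewrite ltr0n. Qed.

(** Measurability refers to the sigma-algebra generated by the directions alone, the one that [XZ]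
    makes independent of [X]. *)
Let mGZ i b : measurable_fun (setT : set (g_sigma_algebraType SZ))
  (fun w => Z i w 0 b).
Proof.
have mZi : measurable_fun (setT : set (g_sigma_algebraType SZ)) (Z i).
  move=> _ A mA; rewrite setTI; apply: sub_sigma_algebra; exists i => //.
  by exists A => //; rewrite setTI.
exact: (measurableT_comp (measurable_coord b) mZi).
Qed.

Lemma sphere_ae_dotp i : {ae Pr, forall w, dotp (Z i w) (Z i w) = d%:R}.
Proof.
have [N [mN N0 sN]] := uniform_on_sphere_ae mu_unif.
have [mZ lawZi] := lawZ i.
exists (Z i @^-1` N); split.
- by rewrite -[X in measurable X]setTI; exact: mZ.
- by rewrite lawZi.
move=> w /= nw; apply: sN => /= zw; apply: nw.
by rewrite -sqr_l2norm zw sqr_sqrtr.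
Qed.

(** The radius [sqrt d] is exactly what turns the scalar covariance [r^2 / d] into the identity. *)
Let has_mean_ZZ i b c : has_mean Pr (fun w => Z i w 0 b * Z i w 0 c) (del b c).
Proof.
have := has_mean_comp (lawZ i) (uniform_on_sphere_covariance mu_unif b c).
by rewrite sqr_sqrtr ?ler0n// divff ?lt0r_neq0// mulr1; apply.
Qed.

Let mZZ b c :
  measurable_fun setT (fun z : 'rV[R]_d => z 0 b * z 0 c).
Proof. by apply: measurable_funM; exact: measurable_coord. Qed.

Let has_mean_ZZZZ i j b c b' c' : i != j ->
  has_mean Pr (fun w => (Z i w 0 b * Z i w 0 c) * (Z j w 0 b' * Z j w 0 c'))
    (del b c * del b' c').
Proof.
move=> ij; apply: has_meanM => //.
apply: indep_systemsS (ZZ ij).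
  exact: (sigma_of_comp (h := fun z : 'rV[R]_d => z 0 b * z 0 c)).
exact: (sigma_of_comp (h := fun z : 'rV[R]_d => z 0 b' * z 0 c')).
Qed.

Let has_mean_XV (h : T -> R) (V : W -> R) a b :
  measurable_fun (setT : set (g_sigma_algebraType SZ)) V ->
  has_mean P h a -> has_mean Pr V b ->
  has_mean Pr (fun w => h (X w) * V w) (a * b).
Proof.
move=> mV ha Vb; apply: has_meanM => //; last exact: has_mean_comp ha.
apply: indep_systemsS XZ; last exact: sigma_of_generated.
by apply: sigma_of_comp; exact: has_mean_measurable ha.
Qed.

Let sum_del (h : 'I_d -> R) b : \sum_c h c * del b c = h b.
Proof.
rewrite (bigD1 b)//= /del eqxx mulr1 big1 ?addr0// => c cb.
by rewrite eq_sym (negbTE cb) mulr0.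
Qed.

Lemma has_mean_dotp_linearized (D : 'rV[R]_d) :
  has_mean Pr (fun w => dotp (linearized_estimate w) D)
    (dotp (\row_b fine 'E_P[(fun x => v x 0 b)%R]) D).
Proof.
have H i b c : has_mean Pr (fun w => D 0 c * (G w b * (Z i w 0 b * Z i w 0 c)))
    (D 0 c * (fine 'E_P[(fun x => v x 0 b)%R] * del b c)).
  apply: has_meanZ; apply: has_mean_XV (has_mean_coord mv iv b) (has_mean_ZZ _
      _ _).
  by apply: measurable_funM; exact: mGZ.
have := has_meanZ (m%:R^-1) (has_mean_sum (index_enum 'I_m) (fun i =>
  has_mean_sum (index_enum 'I_d) (fun b =>
    has_mean_sum (index_enum 'I_d) (fun c => H i b c)))).
congr has_mean.
  apply/funext => w; rewrite /linearized_estimate dotpZl dotp_suml.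
  congr (_ * _); apply: eq_bigr => i _; rewrite dotpZl {1}/dotp mulr_suml.
  apply: eq_bigr => b _; rewrite /dotp mulr_sumr; apply: eq_bigr => c _.
  by rewrite /G; ring.
under eq_bigr => i _.
  under eq_bigr => b _.
    under eq_bigr => c _ do rewrite mulrA.
    rewrite (sum_del (fun c => D 0 c * fine 'E_P[(fun x => v x 0 b)%R])).
    over.
  over.
rewrite sumr_const card_ord -[X in _ * X = _]mulr_natl mulrA mulVf ?mul1r
    ?pnatr_eq0 -?lt0n//.
by apply: eq_bigr => b _; rewrite mxE mulrC.
Qed.

Let cross i j w := dotp (v (X w)) (Z i w) * dotp (v (X w)) (Z j w) *
  dotp (Z i w) (Z j w).

Let Gam := fine 'E_P[(fun x => l2norm (v x) ^+ 2)%R].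

(** In coordinates each monomial splits into a factor of [X], one of [Z i] and one of [Z j]; two
    identity covariances collapse the triple sum to the trace of the second moment of [v]. *)
Let has_mean_cross_neq i j : i != j -> has_mean Pr (cross i j) Gam.
Proof.
move=> ij.
have H b b' c : has_mean Pr (fun w => (G w b * G w b') *
    ((Z i w 0 b * Z i w 0 c) * (Z j w 0 b' * Z j w 0 c)))
    (gam b b' * (del b c * del b' c)).
  apply: (has_mean_XV (h := fun x => v x 0 b * v x 0 b')).
  - by apply: measurable_funM; apply: measurable_funM; exact: mGZ.
  - exact: has_mean_coord2.
  - exact: has_mean_ZZZZ.
have := has_mean_sum (index_enum 'I_d) (fun b => has_mean_sum (index_enum 'I_d)
  (fun b' => has_mean_sum (index_enum 'I_d) (fun c => H b b' c))).
congr has_mean.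
  apply/funext => w; rewrite /cross {1 2}/dotp !mulr_suml.
  apply: eq_bigr => b _; rewrite mulr_sumr mulr_suml; apply: eq_bigr => b' _.
  rewrite /dotp mulr_sumr; apply: eq_bigr => c _; rewrite /G; ring.
rewrite /Gam -sum_mean_coord2//; apply: eq_bigr => b _.
under eq_bigr => b' _.
  under eq_bigr => c _ do rewrite (mulrC (del b c)) mulrA.
  rewrite (sum_del (fun c => gam b b' * del b' c)).
  rewrite /del eq_sym.
  over.
by rewrite (sum_del (gam b)).
Qed.

(** The factor [dotp (Z i w) (Z i w)] equals [d] almost surely, so the apparent fourth moment of
    [Z i] is only a second moment. *)
Let has_mean_cross_eq i : has_mean Pr (cross i i) (d%:R * Gam).
Proof.
have H b b' : has_mean Pr (fun w => (G w b * G w b') *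
    (Z i w 0 b * Z i w 0 b')) (gam b b' * del b b').
  apply: (has_mean_XV (h := fun x => v x 0 b * v x 0 b')).
  - by apply: measurable_funM; exact: mGZ.
  - exact: has_mean_coord2.
  - exact: has_mean_ZZ.
have := has_meanZ d%:R (has_mean_sum (index_enum 'I_d) (fun b =>
  has_mean_sum (index_enum 'I_d) (fun b' => H b b'))).
have -> : \sum_b \sum_b' gam b b' * del b b' = Gam.
  rewrite /Gam -sum_mean_coord2//; apply: eq_bigr => b _.
  by rewrite (sum_del (gam b)).
apply: has_mean_ae.
  have mX : measurable_fun setT (fun w => v (X w)).
    by apply: measurableT_comp => //; case: lawX.
  have mZ : measurable_fun setT (Z i) by case: (lawZ i).
  by apply: measurable_funM; [apply: measurable_funM|]; exact: measurable_dotp.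
apply: filterS (sphere_ae_dotp i) => w Zd; rewrite /cross Zd mulrC; congr (_ *
    _).
rewrite {1 2}/dotp mulr_suml; apply: eq_bigr => b _.
by rewrite mulr_sumr; apply: eq_bigr => b' _; rewrite /G; ring.
Qed.

(** The square has [m^2] cross terms: each contributes [Gam], and the [m] diagonal ones an excess of
    [(d - 1) * Gam]. Division by [m^2] gives the factor. *)
Lemma has_mean_sqr_linearized : has_mean Pr
  (fun w => l2norm (linearized_estimate w) ^+ 2)
  ((1 + (d%:R - 1) / m%:R) * Gam).
Proof.
have H i j : has_mean Pr (cross i j)
    (Gam + (if j == i then (d%:R - 1) * Gam else 0)).
  rewrite eq_sym; have [<-|ij] := eqVneq i j; last by rewrite addr0; exact:
      has_mean_cross_neq.
  rewrite (_ : Gam + _ = d%:R * Gam); [exact: has_mean_cross_eq|ring].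
have := has_meanZ (m%:R^-1 ^+ 2) (has_mean_sum (index_enum 'I_m) (fun i =>
  has_mean_sum (index_enum 'I_m) (fun j => H i j))).
congr has_mean.
  apply/funext => w; rewrite sqr_l2norm /linearized_estimate dotpZl dotpZr.
  rewrite mulrA -expr2 dotp_suml; congr (_ * _); apply: eq_bigr => i _.
  rewrite dotp_sumr; apply: eq_bigr => j _; rewrite dotpZl dotpZr /cross; ring.
under eq_bigr => i _ do rewrite big_split/= -big_mkcond/= big_pred1_eq.
rewrite !sumr_const card_ord -(mulr_natr Gam) -(mulr_natr (_ + _)).
by field; rewrite pnatr_eq0 -lt0n.
Qed.

End LinearizedEstimate.

(** * One step from a fixed point *)

Lemma measurable_grad_estimate (R : realType) (d m : nat)
    (dT d0 : measure_display) (T : measurableType dT) (T0 : measurableType d0)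
    (F : 'rV[R]_d -> T -> \bar R) (u : R) (th : T0 -> 'rV[R]_d) (X : T0 -> T)
    (Z : 'I_m -> T0 -> 'rV[R]_d) :
  measurable_fun setT (fun p : 'rV[R]_d * T => F p.1 p.2) ->
  measurable_fun setT th -> measurable_fun setT X ->
  (forall i, measurable_fun setT (Z i)) ->
  measurable_fun setT
    (fun w => grad_estimate F u (th w) (X w) (fun i => Z i w)).
Proof.
move=> mF mth mX mZ.
have mFF (y : T0 -> 'rV[R]_d) : measurable_fun setT y ->
    measurable_fun setT (fun w => fine (F (y w) (X w))).
  move=> my; apply: measurableT_comp => //.
  exact: (measurableT_comp mF (measurable_fun_pair my mX)).
apply: measurable_rVZ => //; apply: measurable_rV_sum => i.
apply: measurable_rVZ => //; apply: measurable_funM => //.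
apply: measurable_funB; last exact: mFF.
by apply: mFF; apply: measurable_rVD => //; exact: measurable_rVZ.
Qed.

(** Only the inner product with [a] is kept exactly, since its mean is the wanted gap. The error [e]
    is separated by Cauchy-Schwarz in the linear term and by [|a + e|^2 <= 2 |a|^2 + 2 |e|^2] in the
    quadratic one. *)
Lemma sqr_l2norm_step (R : realType) (d : nat) (D a e : 'rV[R]_d) (al : R) :
  0 <= al ->
  l2norm (D - al *: (a + e)) ^+ 2 <= l2norm D ^+ 2 - 2 * al * dotp a D +
    2 * al * (l2norm e * l2norm D) + 2 * al ^+ 2 * l2norm a ^+ 2 +
    2 * al ^+ 2 * l2norm e ^+ 2.
Proof.
move=> al0; rewrite sqr_l2norm dotpBl !dotpBr !dotpZl !dotpZr.
rewrite (dotpC D) -!sqr_l2norm dotpDl.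
have := sqr_l2normD_le a e; have := abs_dotp_le e D.
rewrite ler_norml => /andP[eD _] ae.
have : al * - (l2norm e * l2norm D) <= al * dotp e D by rewrite ler_wpM2l.
have : al ^+ 2 * l2norm (a + e) ^+ 2 <=
    al ^+ 2 * (2 * l2norm a ^+ 2 + 2 * l2norm e ^+ 2).
  by rewrite ler_wpM2l// sqr_ge0.
lra.
Qed.

Section ExpectedStep.
Context {dW dT : measure_display} {W : measurableType dW}.
Context {T : measurableType dT} {R : realType} {d m : nat}.
Variables (Pr : probability W R) (P : probability T R).
Variables (mu : probability 'rV[R]_d R).
Variables (X : W -> T) (Z : 'I_m -> W -> 'rV[R]_d).
Hypotheses (d0 : (0 < d)%N) (m0 : (0 < m)%N).
Hypotheses (lawX : has_law Pr X P) (lawZ : forall i, has_law Pr (Z i) mu).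
Hypothesis mu_unif : uniform_on_sphere mu (Num.sqrt d%:R).
Hypothesis XZ : indep_systems Pr (sigma_of X) <<s \bigcup_i sigma_of (Z i) >>.
Hypothesis ZZ : forall i j, i != j ->
  indep_systems Pr (sigma_of (Z i)) (sigma_of (Z j)).
Variables (F : 'rV[R]_d -> T -> \bar R) (L : T -> R) (LP : R).
Hypothesis mF : measurable_fun setT (fun p : 'rV[R]_d * T => F p.1 p.2).
Hypothesis Fconv : {ae P, forall x, closed_convex_fun (F ^~ x)}.
Hypothesis Flip : {ae P, forall x, lipschitz_gradient (F ^~ x) (L x)}.
Hypotheses (L0 : forall x, 0 <= L x) (LP0 : 0 < LP).
Hypothesis L2 : has_mean P (fun x => L x ^+ 2) (LP ^+ 2).
Variables (th : 'rV[R]_d) (v : T -> 'rV[R]_d) (u u1 : R).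
Hypotheses (u0 : 0 < u) (uu1 : u <= u1).
Hypothesis dom : forall x z, l2norm z = Num.sqrt d%:R ->
  edom (F ^~ x) (th + u1 *: z).
Hypothesis mv : measurable_fun setT v.
Hypothesis sub_v : {ae P, forall x, subdifferential (F ^~ x) th (v x)}.

(** This is [d^(3/2)]: a factor [d = |z|^2] from the finite-difference bound and a factor [sqrt d]
    from the length of the direction it multiplies. *)
Let K : R := d%:R * Num.sqrt d%:R.

Let error_le x (z : 'I_m -> 'rV[R]_d) :
  closed_convex_fun (F ^~ x) -> lipschitz_gradient (F ^~ x) (L x) ->
  subdifferential (F ^~ x) th (v x) ->
  (forall i, l2norm (z i) = Num.sqrt d%:R) ->
  l2norm (grad_estimate F u th x z -
    m%:R^-1 *: \sum_i dotp (v x) (z i) *: z i) <= u * L x * K.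
Proof.
move=> cF lF sF zd.
have sd0 : 0 < Num.sqrt d%:R :> R by rewrite sqrtr_gt0 ltr0n.
rewrite /grad_estimate -scalerBr -sumrB l2normZ gtr0_norm ?invr_gt0 ?ltr0n//.
rewrite ler_pdivrMl ?ltr0n// (le_trans (l2norm_sum_le _ _))//.
rewrite mulr_natl -[in leRHS](card_ord m) -sumr_const ler_sum// => i _.
rewrite -scalerBl l2normZ zd /K mulrA ler_pM2r//.
have := finite_difference_bounds cF lF sd0 (L0 x) u0 uu1 (dom x) sF (zd i).
set A := fine _; set B := fine _; rewrite sqr_sqrtr ?ler0n// => /andP[h1 h2].
have -> : (A - B) / u - dotp (v x) (z i) = (A - B - u * dotp (v x) (z i)) / u.
  by field; rewrite gt_eqF.
rewrite ger0_norm ?divr_ge0 ?(ltW u0)// ler_pdivrMr//.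
by rewrite (le_trans h2)// expr2; lra.
Qed.

Let pullback_ae (Q : T -> Prop) : {ae P, forall x, Q x} ->
  {ae Pr, forall w, Q (X w)}.
Proof.
move=> [N [mN N0 sN]]; have [mX law] := lawX.
exists (X @^-1` N); split; last by move=> w /= nq; exact: sN.
  by rewrite -[X in measurable X]setTI; exact: mX.
by rewrite law.
Qed.

Let sphere_ae : {ae Pr, forall w, forall i, l2norm (Z i w) = Num.sqrt d%:R}.
Proof.
apply: filter_forall => i; have := sphere_ae_dotp lawZ mu_unif i.
by apply: filterS => w; rewrite /l2norm => ->.
Qed.

Lemma expected_step (D0 : 'rV[R]_d) (al rad Gsq gap : R) :
  0 < al -> l2norm (th - D0) <= rad -> 
  ('E_P[(fun x => l2norm (v x) ^+ 2)%R] <= Gsq%:E)%E ->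
  gap <= dotp (\row_b fine 'E_P[(fun x => v x 0 b)%R]) (th - D0) ->
  (\int[Pr]_w (l2norm (th - al *: grad_estimate F u th (X w) (Z^~ w) - D0)
      ^+ 2)%:E <=
   (l2norm (th - D0) ^+ 2 - 2 * al * gap + 2 * al * (u * LP * K * rad) +
    2 * al ^+ 2 * ((1 + d%:R / m%:R) * Gsq) +
    2 * al ^+ 2 * (u * LP * K) ^+ 2)%:E)%E.
Proof.
move=> al0 Drad vG gapD.
have iv := le_lt_trans vG (ltry _).
set D := th - D0; set a := linearized_estimate X Z v.
set gbar := (X in dotp X _) in gapD.
have mX : measurable_fun setT X by case: lawX.
have mZ i : measurable_fun setT (Z i) by case: (lawZ i).
have K0 : 0 <= K by rewrite mulr_ge0// sqrtr_ge0.
have rad0 : 0 <= rad by exact: le_trans (l2norm_ge0 _) Drad.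
(* The error is linear in [L], whose second moment is what is known. By [2 L <= L^2 / LP + LP] it is
   replaced by an expression in [L^2] with mean exactly [2 LP]; the second summand of [c1] comes
   from the squared error. *)
pose c1 := al * u * K * rad / LP + 2 * al ^+ 2 * (u * K) ^+ 2.
pose Q w := l2norm D ^+ 2 + (al * u * K * rad * LP) + - 2 * al * dotp (a w) D +
  2 * al ^+ 2 * l2norm (a w) ^+ 2 + c1 * L (X w) ^+ 2.
pose psi w := l2norm (th - al *: grad_estimate F u th (X w) (Z^~ w) - D0) ^+ 2.
have hQ := has_meanD (has_meanD (has_meanD
    (has_mean_cst Pr (l2norm D ^+ 2 + al * u * K * rad * LP))
    (has_meanZ (- 2 * al) (has_mean_dotp_linearized d0 m0 lawX lawZ mu_unif XZ
        mv iv D)))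
    (has_meanZ (2 * al ^+ 2)
      (has_mean_sqr_linearized d0 m0 lawX lawZ mu_unif XZ ZZ mv iv)))
    (has_meanZ c1 (has_mean_comp lawX L2)).
rewrite -/gbar in hQ; set q := (X in has_mean _ _ X) in hQ.
have psiQ : {ae Pr, forall w, psi w <= Q w}.
  near=> w.
  have cF : closed_convex_fun (F ^~ (X w)).
    by near: w; exact: (pullback_ae Fconv).
  have lF : lipschitz_gradient (F ^~ (X w)) (L (X w)).
    by near: w; exact: (pullback_ae Flip).
  have sF : subdifferential (F ^~ (X w)) th (v (X w)).
    by near: w; exact: (pullback_ae sub_v).
  have zd : forall i, l2norm (Z i w) = Num.sqrt d%:R.
    by near: w; exact: sphere_ae.
  have := error_le cF lF sF zd; rewrite -/(linearized_estimate X Z v w) -/a.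
  set ghat := grad_estimate _ _ _ _ _ => eK.
  have := sqr_l2norm_step D (a w) (ghat - a w) (ltW al0).
  have -> : D - al *: (a w + (ghat - a w)) = th - al *: ghat - D0.
    by rewrite (addrCA (a w)) subrr addr0 /D addrAC.
  rewrite -/(psi w) => /le_trans; apply; rewrite /Q /c1.
  move: eK; set e := l2norm (ghat - a w) => eK.
  have e0 : 0 <= e by exact: l2norm_ge0.
  have e2 : al ^+ 2 * e ^+ 2 <= al ^+ 2 * (u * L (X w) * K) ^+ 2.
    by rewrite ler_wpM2l ?sqr_ge0// ler_pXn2r// nnegrE (le_trans e0).
  have eD : al * (e * l2norm D) <= al * (u * L (X w) * K * rad).
    by rewrite ler_pM2l// ler_pM// l2norm_ge0.
  have LL : 2 * L (X w) <= L (X w) ^+ 2 / LP + LP.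
    rewrite -(ler_pM2r LP0) [leRHS]mulrDl divfK ?gt_eqF//.
    by have := sqr_ge0 (L (X w) - LP); rewrite sqrrB; lra.
  have : (al * u * K * rad) * (2 * L (X w)) <=
      (al * u * K * rad) * (L (X w) ^+ 2 / LP + LP).
    by rewrite ler_wpM2l// !mulr_ge0// ltW.
  lra.
have mpsi : measurable_fun setT psi.
  apply: measurable_funX; apply: (measurableT_comp measurable_l2norm).
  apply: measurable_rVB => //; apply: measurable_rVB => //.
  by apply: measurable_rVZ => //; exact: measurable_grad_estimate.
have mQ := has_mean_measurable hQ.
have psi0 w : 0 <= psi w by exact: sqr_ge0.
(* The bound by [Q] holds almost everywhere, and [Q] could be negative on the exceptional set; the
   absolute value is nonnegative everywhere and has the same integral. *)
apply: (@le_trans _ _ (\int[Pr]_w `|Q w|%:E)%E).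
  apply: ae_ge0_le_integral => //.
  - by move=> w _; rewrite lee_fin; exact: psi0.
  - exact/measurable_EFinP.
  - by apply/measurable_EFinP; exact: measurableT_comp.
  by apply: filterS psiQ => w pQ _; rewrite lee_fin (le_trans pQ)// ler_norm.
have -> : (\int[Pr]_w `|Q w|%:E = q%:E)%E.
  rewrite -hQ.2; apply: ae_eq_integral => //.
  - by apply/measurable_EFinP; exact: measurableT_comp.
  - exact/measurable_EFinP.
  apply: filterS psiQ => w pQ _; congr EFin; rewrite ger0_norm//.
  exact: le_trans pQ.
rewrite lee_fin /q /c1.
set Gam := fine _.
have GamE : (Gam%:E = 'E_P[(fun x => l2norm (v x) ^+ 2)%R])%E.
  by rewrite -(has_mean_sqr_l2norm mv iv).2 unlock.
have Gam_le : Gam <= Gsq by rewrite -lee_fin GamE.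
have Gam0 : 0 <= Gam.
  apply: has_mean_le (has_mean_cst P 0) (has_mean_sqr_l2norm mv iv) _ => x.
  exact: sqr_ge0.
have r1 : (1 + (d%:R - 1) / m%:R) * Gam <= (1 + d%:R / m%:R) * Gsq.
  apply: ler_pM => //.
    by rewrite addr_ge0// divr_ge0// subr_ge0 ler1n.
  by rewrite lerD2l ler_pM2r ?invr_gt0 ?ltr0n// gerBl.
have r2 : al * gap <= al * dotp gbar D by rewrite ler_pM2l.
have r3 : al ^+ 2 * ((1 + (d%:R - 1) / m%:R) * Gam) <=
    al ^+ 2 * ((1 + d%:R / m%:R) * Gsq) by rewrite ler_wpM2l ?sqr_ge0.
have r4 : al * u * K * rad / LP * LP ^+ 2 = al * u * K * rad * LP.
  by rewrite expr2 mulrA divfK ?gt_eqF.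
rewrite (mulrDl _ _ (LP ^+ 2)) r4; lra.
Unshelve. all: by end_near. Qed.

End ExpectedStep.

(** * Proximal steps and step-size sums *)

Section ProximalStep.
Context {R : realType} {d : nat}.
Implicit Types (Theta : set 'rV[R]_d) (g p q y b : 'rV[R]_d).

(** The first-order condition saying that [p] is the projection of [th0 - al *: g] onto [Theta].
    Moving from [p] towards [b] by a fraction [s] must not lower the quadratic objective, which
    gives [0 <= 2 * c + s * N]. *)
Lemma prox_variational Theta (al : R) g th0 p b :
  convex_set (Theta : set (convex_lmodType 'rV[R]_d)) -> 0 < al ->
  is_argmin Theta (prox_objective al g th0) p -> Theta b ->
  0 <= dotp (p - (th0 - al *: g)) (b - p).
Proof.
move=> cT al0 [Tp pmin] Tb; set N := dotp (b - p) (b - p).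
set c := dotp _ (b - p).
have N0 : 0 <= N by exact: dotp_ge0.
have cN s : 0 < s -> s < 1 -> 0 <= 2 * c + s * N.
  move=> s0 s1; have := pmin _ (convex_set_comb cT Tb Tp (ltW s0) (ltW s1)).
  have -> : s *: b + (1 - s) *: p = p + s *: (b - p).
    by rewrite scalerBr scalerBl scale1r addrCA.
  rewrite /prox_objective !sqr_l2norm (addrAC p) !(dotpDl, dotpDr) dotpNl
      dotpNr.
  rewrite !(dotpZl, dotpZr) -/N => pq.
  have : 0 <= s * (2 * c + s * N).
    rewrite -(pmulr_rge0 _ (_ : 0 < (2 * al)^-1)); last first.
      by rewrite invr_gt0 mulr_gt0.
    move: pq; rewrite -subr_ge0; congr (0 <= _).
    rewrite /c !(dotpDl, dotpDr, dotpNl, dotpNr) !(dotpZl, dotpZr).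
    rewrite (dotpC th0 p) (dotpC b p) (dotpC b th0).
    by field; rewrite gt_eqF.
  by rewrite pmulr_rge0.
rewrite leNgt; apply/negP => c0.
(* The witness [s = - c / (N + 1 - c)] lies strictly between 0 and 1 and satisfies [s * N <= - c],
   whence [2 * c + s * N <= c < 0]. *)
have sN : 0 < N + 1 - c by lra.
have := cN (- c / (N + 1 - c)) _ _; rewrite divr_gt0 ?oppr_gt0// => /(_ isT).
rewrite ltr_pdivrMr// mul1r => /(_ ltac:(lra)).
rewrite leNgt => /negP; apply.
have : - c / (N + 1 - c) * N <= - c.
  by rewrite mulrAC ler_pdivrMr// ler_pM2l ?oppr_gt0//; lra.
lra.
Qed.

(** Adding the two inequalities bounds [|p - q|^2] by [dotp (y - y') (p - q)]; Cauchy-Schwarz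
    concludes. It serves twice: for two outcomes of the same step, and with [q] and [y'] both equal
    to the minimizer. *)
Lemma variational_nonexpansive p q y y' :
  0 <= dotp (p - y) (q - p) -> 0 <= dotp (q - y') (p - q) ->
  l2norm (p - q) <= l2norm (y - y').
Proof.
move=> py qy; have : l2norm (p - q) ^+ 2 <= dotp (y - y') (p - q).
  move: py qy; rewrite sqr_l2norm !(dotpDl, dotpDr, dotpNl, dotpNr).
  rewrite (dotpC q p); lra.
move=> /le_trans /(_ (dotp_le_l2norm _ _)).
have [->|pq0] := eqVneq (l2norm (p - q)) 0; first by rewrite l2norm_ge0.
by rewrite expr2 ler_pM2r// lt0r pq0 l2norm_ge0.
Qed.

(** The map from [y w] to [p w] is known on the range of [y] only. The preimage of an open [U] is
    nevertheless that of an open set [V]: around each [y w'] put a ball with the radius of a ball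
    around [p w'] inside [U]. *)
Lemma measurable_nonexpansive (dT : measure_display) (T : measurableType dT)
    (y p : T -> 'rV[R]_d) : measurable_fun setT y ->
  (forall w w', l2norm (p w - p w') <= l2norm (y w - y w')) ->
  measurable_fun setT p.
Proof.
move=> my pyle; apply: (@measurability _ _ _ _ _ _ (@open 'rV[R]_d)) => //.
move=> _ [U oU <-]; rewrite setTI.
have ball_U w : U (p w) -> exists2 e : R,
    0 < e & [set z | l2norm (z - p w) < e] `<=` U.
  exact: open_l2ball_sub.
pose V := \bigcup_(we in [set we : T * R | 0 < we.2 /\
  [set z | l2norm (z - p we.1) < we.2] `<=` U])
  [set z | l2norm (z - y we.1) < we.2].
rewrite (_ : p @^-1` U = y @^-1` V).
  rewrite -[X in measurable X]setTI; apply: my => //.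
  apply: measurable_rV_open; apply: bigcup_open => we _.
  exact: open_l2ball.
apply/seteqP; split=> [w Uw|w [[w' e]] [/= e0 eU] ye].
  have [e e0 eU] := ball_U _ Uw.
  by exists (w, e) => //=; rewrite subrr l2norm0.
by apply: eU => /=; exact: le_lt_trans (pyle _ _) ye.
Qed.

End ProximalStep.

Section RealSums.
Context {R : realType}.
Implicit Types (k t : nat).

Lemma sum_inv_sqrt_le k :
  \sum_(1 <= t < k.+1) (Num.sqrt t%:R)^-1 <= 2 * Num.sqrt k%:R :> R.
Proof.
elim: k => [|k IH]; first by rewrite big_geq// sqrtr0 mulr0.
rewrite big_nat_recr//= (le_trans (lerD IH (lexx _)))//.
set a := Num.sqrt k.+1%:R; set b := Num.sqrt k%:R.
have a0 : 0 < a by rewrite sqrtr_gt0 ltr0n.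
have b0 : 0 <= b by exact: sqrtr_ge0.
have ab : a ^+ 2 = b ^+ 2 + 1 by rewrite !sqr_sqrtr ?ler0n// -natr1.
(* From [(a - b)^2 >= 0] and [a^2 = b^2 + 1] follows [1 / a <= 2 a - 2 b], the telescoping bound. *)
rewrite -(ler_pM2r a0) mulrDl mulVf ?gt_eqF//.
have := sqr_ge0 (a - b); rewrite sqrrB -mulr_natr; move: ab; rewrite !expr2;
    lra.
Qed.

(** Factor [a^4 - b^4 = 1] as [a - b] times a sum of four monomials, each at most [a^3], hence at
    most [a^4]. *)
Lemma fourth_root_step (a b : R) : 1 <= a -> 0 <= b -> b <= a ->
  a ^+ 4 = b ^+ 4 + 1 -> (a ^+ 4)^-1 <= 4 * a - 4 * b.
Proof.
move=> a1 b0 ba ab.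
have a0 : 0 < a ^+ 4 by rewrite exprn_gt0// (lt_le_trans ltr01).
rewrite -(ler_pM2r a0) mulVf ?gt_eqF//.
have -> : (4 * a - 4 * b) * a ^+ 4 = (a - b) * (4 * a ^+ 4) by ring.
apply: (@le_trans _ _
    ((a - b) * (a ^+ 3 + a ^+ 2 * b + a * b ^+ 2 + b ^+ 3))).
  rewrite (_ : _ * _ = a ^+ 4 - b ^+ 4); last by ring.
  by rewrite ab addrAC subrr add0r.
rewrite ler_wpM2l ?subr_ge0//.
have a30 : 0 <= a ^+ 3 by rewrite exprn_ge0// (le_trans ler01).
have h1 : a ^+ 2 * b <= a ^+ 3.
  by rewrite (exprSr a 2) ler_wpM2l// sqr_ge0.
have h2 : a * b ^+ 2 <= a ^+ 3.
  rewrite (exprS a 2) ler_wpM2l ?(le_trans ler01)//.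
  by rewrite ler_pXn2r// nnegrE (le_trans ler01).
have h3 : b ^+ 3 <= a ^+ 3 by rewrite ler_pXn2r// nnegrE (le_trans ler01).
have h4 : a ^+ 3 <= a ^+ 4 by rewrite (exprS a 3) ler_peMl.
lra.
Qed.

(** The power [k^(1/4)] replaces a logarithm on purpose: after averaging, the bias becomes a
    geometric mean that AM-GM can split. *)
Lemma sum_inv_le k : \sum_(1 <= t < k.+1) t%:R^-1 <=
  4 * Num.sqrt (Num.sqrt k%:R) :> R.
Proof.
elim: k => [|k IH]; first by rewrite big_geq// !sqrtr0 mulr0.
rewrite big_nat_recr//= (le_trans (lerD IH (lexx _)))//.
set a := Num.sqrt (Num.sqrt k.+1%:R); set b := Num.sqrt (Num.sqrt k%:R).
have a1 : 1 <= a by rewrite -[leLHS]sqrtr1 ler_sqrt// -[leLHS]sqrtr1 ler_sqrt//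
    ler1n.
have b0 : 0 <= b by exact: sqrtr_ge0.
have a4 : k.+1%:R = a ^+ 4.
  by rewrite -[4%N]/(2 * 2)%N exprM !sqr_sqrtr ?sqrtr_ge0.
have b4 : k%:R = b ^+ 4.
  by rewrite -[4%N]/(2 * 2)%N exprM !sqr_sqrtr ?sqrtr_ge0.
have ba : b <= a by rewrite ler_sqrt ?sqrtr_ge0// ler_sqrt// ler_nat.
have ab : a ^+ 4 = b ^+ 4 + 1 by rewrite -a4 -b4 natr1.
by rewrite a4 -lerBrDl; exact: fourth_root_step.
Qed.

(** Since [t^(-1/2) <= 1], each term after the first is at most [1/t^2 <= 1/(t-1) - 1/t]; the
    subtracted [1/k] makes the induction close. *)
Lemma sum_inv_sqr_le k : (0 < k)%N ->
  \sum_(1 <= t < k.+1) ((Num.sqrt t%:R)^-1 * t%:R^-1 ^+ 2) <= 2 - k%:R^-1 :> R.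
Proof.
elim: k => // -[_ _|k IH _]; first by rewrite big_nat1 sqrtr1 !invr1; lra.
rewrite big_nat_recr//= (le_trans (lerD (IH isT) (lexx _)))//.
have ba : k.+2%:R = k.+1%:R + 1 :> R by rewrite natr1.
have a0 : 0 < k.+1%:R :> R by rewrite ltr0n.
move: ba a0; move: (k.+1%:R : R) (k.+2%:R : R) => a b -> a0 {b}.
have s1 : (Num.sqrt (a + 1))^-1 <= 1.
  rewrite invf_le1 ?sqrtr_gt0 ?ltr_wpDr//.
  by rewrite -[leLHS]sqrtr1 ler_wsqrtr// lerDr ltW.
suff : (Num.sqrt (a + 1))^-1 * (a + 1)^-1 ^+ 2 <= a^-1 - (a + 1)^-1 by lra.
have -> : a^-1 - (a + 1)^-1 = (a * (a + 1))^-1.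
  by field; rewrite !gt_eqF// addr_gt0.
rewrite (@le_trans _ _ ((a + 1)^-1 ^+ 2))//.
  by rewrite ler_piMl// sqr_ge0.
rewrite exprVn lef_pV2 ?posrE ?exprn_gt0 ?mulr_gt0 ?addr_gt0//.
by rewrite expr2 ler_pM2r ?addr_gt0// lerDl.
Qed.

(** Summation by parts: the increments of [b] are nonnegative and each meets a value of [D] at most
    [r]. The induction carries the last term [D k.+1 * b k], dropped at the end. *)
Lemma sum_telescope_le (D b : nat -> R) (r : R) k : (0 < k)%N ->
  (forall t, 0 <= D t <= r) ->
  (forall t, 0 <= b t) -> (forall t, b t <= b t.+1) ->
  \sum_(1 <= t < k.+1) (D t - D t.+1) * b t <= r * b k.
Proof.
move=> k0 Dr b0 bS.
suff : \sum_(1 <= t < k.+1) (D t - D t.+1) * b t <= r * b k - D k.+1 * b k.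
  move=> /le_trans; apply; rewrite gerBl mulr_ge0//.
  by have /andP[] := Dr k.+1.
elim: k k0 => // -[_ _|k IH _].
  by rewrite big_nat1 mulrBl lerD2r ler_wpM2r//; have /andP[] := Dr 1%N.
rewrite big_nat_recr//= (le_trans (lerD (IH isT) (lexx _)))//.
have : 0 <= (r - D k.+2) * (b k.+2 - b k.+1).
  by rewrite mulr_ge0// subr_ge0//; have /andP[] := Dr k.+2.
lra.
Qed.

End RealSums.

(* [q = k^(1/4)]; the smoothing bias [4 u / q] is absorbed by the other terms
   through AM-GM, so the logarithmic term of the rate is pure slack. *)
Lemma bracket_le (R : realType) (al u B M q : R) :
  0 < al -> 0 < u -> 1 <= M -> M ^+ 2 <= B -> B <= 2 * M ^+ 2 -> 1 <= q ->
  M * al^-1 + 4 * u * q^-1 + al * (B * M^-1) + al * u ^+ 2 * M^-1 * q^-1 ^+ 2 <=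
  5 * (Num.sqrt B * (Num.max al al^-1 + al * u ^+ 2 * q^-1 ^+ 2)).
Proof.
move=> al0 u0 M1 MB BM q1; set s := Num.sqrt B; set x := Num.max _ _.
have M0 : 0 < M by exact: lt_le_trans M1.
have ai0 : 0 < al^-1 by rewrite invr_gt0.
have B0 : 0 <= B by rewrite (le_trans _ MB)// sqr_ge0.
have Ms : M <= s by rewrite -[leLHS]gtr0_norm// -sqrtr_sqr ler_wsqrtr.
have s1 : 1 <= s by exact: le_trans Ms.
have s0 : 0 < s by exact: lt_le_trans s1.
have sM : s <= 2 * M.
  have M20 : 0 <= 2 * M by rewrite mulr_ge0// ltW.
  rewrite -(@ler_pXn2r _ 2)// ?nnegrE ?(ltW s0)//.
  by rewrite sqr_sqrtr// exprMn (le_trans BM)// ler_pM2r ?exprn_gt0//; lra.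
have BMs : B * M^-1 <= 2 * s.
  rewrite ler_pdivrMr// -[leLHS]sqr_sqrtr// expr2 mulrAC.
  by rewrite ler_pM2r// mulrC.
have alx : al <= x by rewrite le_max lexx.
have aix : al^-1 <= x by rewrite le_max lexx orbT.
set p := q^-1.
have p0 : 0 <= p by rewrite invr_ge0 (le_trans _ q1).
have amgm : 4 * u * p <= 2 * al^-1 + 2 * (al * u ^+ 2 * p ^+ 2).
  have : 0 <= 2 * al^-1 * (1 - al * (u * p)) ^+ 2.
    by rewrite mulr_ge0 ?sqr_ge0// mulr_ge0// ltW.
  have -> : 2 * al^-1 * (1 - al * (u * p)) ^+ 2 =
      2 * al^-1 + 2 * (al * u ^+ 2 * p ^+ 2) - 4 * u * p.
    by field; rewrite gt_eqF.
  lra.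
set y := al * u ^+ 2 * p ^+ 2 in amgm *.
have y0 : 0 <= y by rewrite !mulr_ge0 ?sqr_ge0// ltW.
have yM : al * u ^+ 2 * M^-1 * p ^+ 2 <= y.
  by rewrite /y mulrAC ler_piMr// invf_le1.
(* The constant 5 is counted on [s * x]: one from [h1], two from [h2], two from [amgm]. On [s * y]
   the total is three. *)
have h1 : M * al^-1 <= s * x by rewrite ler_pM// ltW.
have h2 : al * (B * M^-1) <= 2 * (s * x).
  rewrite (@le_trans _ _ (al * (2 * s)))// ?ler_pM2l//.
  by have := ler_wpM2r (ltW s0) alx; lra.
have x0 : 0 <= x by rewrite (le_trans _ alx)// ltW.
have h3 : 2 * x + 3 * y <= s * (2 * x + 3 * y) by rewrite ler_peMl//; lra.
have h4 : y <= s * y by rewrite ler_peMl.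
lra.
Qed.

(** * Deterministic rate from summed step inequalities *)

Section Rate.
Context {R : realType}.
Variables (d m : nat) (rad G al u : R).
Hypotheses (rad0 : 0 < rad) (G0 : 0 < G) (al0 : 0 < al)
  (u0 : 0 < u).

Let B : R := 1 + d%:R / m%:R.
Let a := step_size d m rad G al.
Let M : R := Num.max (Num.sqrt (d%:R / m%:R)) 1.
Let r0 : 0 <= d%:R / m%:R :> R. Proof. by rewrite divr_ge0. Qed.
Let M1 : 1 <= M. Proof. by rewrite le_max lexx orbT. Qed.
Let M0 : 0 < M. Proof. exact: lt_le_trans M1. Qed.

(** With [r = d / m], [M^2] is the maximum of [r] and 1, while [B] is their sum. *)
Let M2 : M ^+ 2 <= B <= 2 * M ^+ 2.
Proof.
have rge0 := r0.
have sr : Num.sqrt (d%:R / m%:R) ^+ 2 = d%:R / m%:R :> R by rewrite sqr_sqrtr.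
rewrite /M /B; have [h|h] := leP (Num.sqrt (d%:R / m%:R) : R) 1.
  have : Num.sqrt (d%:R / m%:R) ^+ 2 <= 1 :> R by rewrite exprn_ile1.
  by rewrite expr1n sr => ?; apply/andP; split; lra.
have : 1 <= Num.sqrt (d%:R / m%:R) ^+ 2 :> R by rewrite exprn_ege1// ltW.
by rewrite sr => ?; apply/andP; split; lra.
Qed.

Lemma step_size_gt0 t : (0 < t)%N -> 0 < a t.
Proof.
move=> t0; have s0 : 0 < Num.sqrt t%:R :> R by rewrite sqrtr_gt0 ltr0n.
rewrite /a /step_size -/M mulr_gt0 ?invr_gt0// mulr_gt0// divr_gt0//.
by rewrite !mulr_gt0.
Qed.

Lemma average_gap_le (D : nat -> R) k : (0 < k)%N ->
  (forall t, 0 <= D t <= rad ^+ 2) ->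
  k%:R^-1 * (\sum_(1 <= t < k.+1) (D t - D t.+1 +
      (2 * a t * (u * G * t%:R^-1 * rad) + 2 * a t ^+ 2 * (B * G ^+ 2) +
       2 * a t ^+ 2 * (u * G * t%:R^-1) ^+ 2)) / (2 * a t)) <=
  5 * (rad * G * Num.sqrt B / Num.sqrt k%:R) *
    (Num.max al al^-1 + al * u ^+ 2 * (Num.sqrt k%:R)^-1 +
     u * (ln (2 * k%:R) / k%:R)).
Proof.
move=> k0 Drad.
(* Here [b t] is [1 / (2 * a t)] and [a0] is [a t] without its factor [1 / sqrt t], so the sum
   splits into four explicit ones. *)
pose b t : R := G * M * Num.sqrt t%:R / (al * rad).
pose a0 : R := al * (rad / (2 * G * M)).
rewrite (@eq_big_nat _ _ _ 1 k.+1 _ (fun t => (D t - D t.+1) * b t +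
  u * G * rad * t%:R^-1 + a0 * (B * G ^+ 2) * (Num.sqrt t%:R)^-1 +
  a0 * (u * G) ^+ 2 * ((Num.sqrt t%:R)^-1 * t%:R^-1 ^+ 2))); last first.
  move=> t /andP[t0 _].
  have st0 : Num.sqrt t%:R != 0 :> R by rewrite gt_eqF// sqrtr_gt0 ltr0n.
  have tn0 : t%:R != 0 :> R by rewrite pnatr_eq0 -lt0n.
  rewrite /a /step_size -/M /b /a0.
  move: st0 tn0; move: (Num.sqrt t%:R) => st; move: (t%:R : R) => tn st0 tn0.
  by field; rewrite st0 tn0 !gt_eqF.
rewrite !big_split/= -!mulr_sumr.
have S1 : \sum_(1 <= t < k.+1) (D t - D t.+1) * b t <= rad ^+ 2 * b k.
  apply: sum_telescope_le => // t.
    by rewrite divr_ge0 ?mulr_ge0 ?sqrtr_ge0// ltW.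
  rewrite ler_pM2r ?invr_gt0 ?mulr_gt0// ler_pM2l ?mulr_gt0//.
  by rewrite ler_wsqrtr// ler_nat.
have S2 := @sum_inv_le R k.
have S3 := @sum_inv_sqrt_le R k.
have S4 := @sum_inv_sqr_le R k k0.
set q : R := Num.sqrt (Num.sqrt k%:R) in S2.
have q1 : 1 <= q.
  by rewrite -[leLHS]sqrtr1 ler_wsqrtr// -[leLHS]sqrtr1 ler_wsqrtr// ler1n.
have q2 : Num.sqrt k%:R = q ^+ 2 by rewrite sqr_sqrtr ?sqrtr_ge0.
have q4 : k%:R = q ^+ 4.
  by rewrite -[4%N]/(2 * 2)%N exprM -q2 sqr_sqrtr.
have a00 : 0 < a0 by rewrite mulr_gt0// divr_gt0// !mulr_gt0.
have B0 : 0 < B by rewrite ltr_pwDl.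
have qn0 : q != 0 by rewrite gt_eqF// (lt_le_trans _ q1).
have {}S2 := ler_wpM2l (ltW (mulr_gt0 (mulr_gt0 u0 G0) rad0)) S2.
have {}S3 := ler_wpM2l (ltW (mulr_gt0 a00 (mulr_gt0 B0 (exprn_gt0 2 G0)))) S3.
have {}S4 : a0 * (u * G) ^+ 2 *
    \sum_(1 <= t < k.+1) ((Num.sqrt t%:R)^-1 * t%:R^-1 ^+ 2) <=
    a0 * (u * G) ^+ 2 * 2.
  apply: ler_wpM2l; first by rewrite mulr_ge0 ?sqr_ge0// ltW.
  by rewrite (le_trans S4)// gerBl invr_ge0.
have kV0 : 0 <= k%:R^-1 :> R by rewrite invr_ge0.
rewrite (le_trans (ler_wpM2l kV0 (lerD (lerD (lerD S1 S2) S3) S4)))//.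
rewrite /b q2 q4.
have /andP[M2l M2r] := M2.
have := bracket_le al0 u0 M1 M2l M2r q1.
set x := Num.max al _; set s := Num.sqrt B => br.
rewrite [leLHS](_ : _ = rad * G * q^-1 ^+ 2 * (M * al^-1 + 4 * u * q^-1 +
    al * (B * M^-1) + al * u ^+ 2 * M^-1 * q^-1 ^+ 2)); last first.
  by rewrite /a0; field; rewrite qn0 !gt_eqF.
have rGq : 0 <= rad * G * q^-1 ^+ 2.
  by rewrite mulr_ge0 ?sqr_ge0// mulr_ge0// ltW.
rewrite (le_trans (ler_wpM2l rGq br))//.
rewrite (_ : 5 * (rad * G * s / q ^+ 2) * _ = rad * G * q^-1 ^+ 2 *
    (5 * (s * (x + al * u ^+ 2 * q^-1 ^+ 2 + u * (ln (2 * q ^+ 4) / q ^+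
        4))))); last first.
  by rewrite exprVn; ring.
rewrite ler_wpM2l// ler_pM2l// ler_wpM2l ?sqrtr_ge0// lerDl.
rewrite mulr_ge0 ?(ltW u0)// divr_ge0// -q4// ln_ge0//.
by rewrite -natrM ler1n muln_gt0.
Qed.

End Rate.

(** * The iteration *)

Lemma convex_set_average (R : realType) (V : lmodType R)
    (A : set (convex_lmodType V)) (x : nat -> V) (k : nat) :
  convex_set A -> (forall t, (0 < t)%N -> A (x t)) -> (0 < k)%N ->
  A (k%:R^-1 *: \sum_(1 <= t < k.+1) x t : V).
Proof.
move=> cA Ax; elim: k => // -[_ _|k IH _].
  by rewrite big_nat1 invr1 scale1r; exact: Ax.
have s0 : 0 < k.+2%:R :> R by rewrite ltr0n.
have e : (1 - k.+2%:R^-1) * k.+1%:R^-1 = k.+2%:R^-1 :> R.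
  have ba : k.+2%:R = k.+1%:R + 1 :> R by rewrite natr1.
  have a0 : 0 < k.+1%:R :> R by rewrite ltr0n.
  move: ba a0; move: (k.+1%:R : R) (k.+2%:R : R) => a b -> a0.
  by field; rewrite !gt_eqF// addr_gt0.
have := convex_set_comb (s := k.+2%:R^-1) cA (Ax k.+2 isT) (IH isT).
rewrite invr_ge0 ltW// invf_le1// ler1n => /(_ isT isT).
congr (A _); rewrite scalerA e -scalerDr [in RHS]big_nat_recr//=.
by rewrite addrC.
Qed.

Lemma sigma_of_setI (d : measure_display) (W : Type) (T : measurableType d)
    (Y : W -> T) : setI_closed (sigma_of Y).
Proof.
move=> _ _ [A mA <-] [B mB <-]; exists (A `&` B); first exact: measurableI.
by rewrite !setTI preimage_setI.
Qed.

Lemma sigma_of_setT (d : measure_display) (W : Type) (T : measurableType d)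
    (Y : W -> T) : sigma_of Y setT.
Proof. by exists setT => //; rewrite setTI preimage_setT. Qed.

Lemma sigma_of_measurable (dW d : measure_display) (W : measurableType dW)
    (T : measurableType d) (Y : W -> T) :
  measurable_fun setT Y -> sigma_of Y `<=` measurable.
Proof. by move=> mY _ [A mA <-]; exact: mY. Qed.

Lemma measurable_fun_generated (d : measure_display) (W : pointedType)
    (T : measurableType d) (G : set (set W)) (Y : W -> T) :
  sigma_of Y `<=` <<s G >> ->
  measurable_fun (setT : set (g_sigma_algebraType G)) Y.
Proof. by move=> YG _ A mA; apply: YG; exists A. Qed.

(** The power [d^(3/2)] in the smoothing parameter cancels the dimension factor of the error,
    leaving a bias free of [d] and [LP]. *)
Lemma smoothingE (R : realType) (d : nat) (G LP u : R) (t : nat) :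
  (0 < d)%N -> 0 < LP ->
  smoothing d G LP u t * LP * (d%:R * Num.sqrt d%:R) = u * G * t%:R^-1.
Proof.
move=> d0 LP0; have dpos : 0 < d%:R :> R by rewrite ltr0n.
have -> : d%:R * Num.sqrt d%:R = d%:R `^ (3 / 2) :> R.
  have -> : 3 / 2 = 1 + 2^-1 :> R by field.
  by rewrite powRD ?gt_eqF ?implybT// powRr1 ?ltW// powR12_sqrt// ltW.
rewrite /smoothing; have := powR_gt0 (3 / 2) dpos.
move: (_ `^ _) => p p0; move: (t%:R^-1) => i.
by field; rewrite !gt_eqF.
Qed.

Section StochasticMirrorDescent.
Context {R : realType} {d m : nat} {dX dW : measure_display}.
Context {X : measurableType dX} {W : measurableType dW}.
Variables (P : probability X R) (Theta : set 'rV[R]_d).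
Variables (F : 'rV[R]_d -> X -> \bar R) (thetastar : 'rV[R]_d).
Variables (g : 'rV[R]_d -> X -> 'rV[R]_d) (L : X -> R).
Variables (rad G : R) (mu : probability 'rV[R]_d R) (alpha u : R).
Variables (Pr : probability W R) (Xs : nat -> W -> X).
Variables (Zs : nat -> 'I_m -> W -> 'rV[R]_d).
Variables (theta1 : 'rV[R]_d) (theta : nat -> W -> 'rV[R]_d).
Let f := fun th : 'rV[R]_d => (\int[P]_x F th x)%E.
Let LP := Num.sqrt (fine 'E_P[(fun x => L x ^+ 2)%R]%E).
Let ut := smoothing d G LP u.
Let alphat := step_size d m rad G alpha.
Hypothesis d0 : (0 < d)%N.
Hypothesis convTheta : convex_set (Theta : set (convex_lmodType 'rV[R]_d)).
Hypothesis mF : measurable_fun setT (fun p : 'rV[R]_d * X => F p.1 p.2).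
Hypothesis Fconv : {ae P, forall x, closed_convex_fun (F ^~ x)}.
Hypothesis fmin : is_argmin Theta f thetastar.
Hypothesis mg : forall th, Theta th -> measurable_fun setT (g th).
Hypothesis sub_g : forall th, Theta th ->
  {ae P, forall x, subdifferential (F ^~ x) th (g th x)}.
Hypothesis sub_f : forall th, Theta th ->
  subdifferential f th (\row_i fine 'E_P[(fun x => g th x 0 i)%R]%E).
Hypotheses (rad0 : 0 < rad) (G0 : 0 < G).
Hypothesis Theta_rad : forall th, Theta th -> l2norm (th - thetastar) <= rad.
Hypothesis dom : forall (x : X) (th z : 'rV[R]_d), Theta th -> msupport mu z ->
  edom (F ^~ x) (th + ut 1%N *: z).
Hypothesis mL : measurable_fun setT L.
Hypothesis L0 : forall x, 0 <= L x.
Hypothesis Flip : {ae P, forall x, lipschitz_gradient (F ^~ x) (L x)}.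
Hypothesis L2 : ('E_P[(fun x => L x ^+ 2)%R]%E < +oo)%E.
Hypothesis LP0 : 0 < LP.
Hypothesis mu_unif : uniform_on_sphere mu (Num.sqrt d%:R).
Hypothesis gG : forall th, Theta th ->
  ('E_P[(fun x => l2norm (g th x) ^+ 2)%R]%E <= (G ^+ 2)%:E)%E.
Hypotheses (m0 : (0 < m)%N) (alpha0 : 0 < alpha) (u0 : 0 < u).
Hypothesis lawX : forall t, (0 < t)%N -> has_law Pr (Xs t) P.
Hypothesis lawZ : forall t i, (0 < t)%N -> has_law Pr (Zs t i) mu.
Hypothesis indep : mutually_independent Pr (sample_sigma Xs Zs).
Hypothesis Theta1 : Theta theta1.
Hypothesis theta_1 : forall w, theta 1%N w = theta1.
Hypothesis theta_S : forall t w, (0 < t)%N ->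
  is_argmin Theta
    (prox_objective (alphat t)
      (grad_estimate F (ut t) (theta t w) (Xs t w) (fun i => Zs t i w))
      (theta t w))
    (theta t.+1 w).

Let S := sample_sigma Xs Zs.
Let time (j : nat + nat * 'I_m) : nat :=
  match j with inl t => t | inr (t, _) => t end.
(** Index [t] stands for time [t.+1]: [past n] holds the samples of times 1 to [n], which determine
    [theta n.+1], and [present n] those of time [n.+1]. *)
Let past n : set (set W) := \bigcup_(j in [set j | (time j < n)%N]) S j.
Let present n : set (set W) := \bigcup_(j in [set j | time j = n]) S j.

Let mXs n : measurable_fun setT (Xs n.+1).
Proof. by case: (@lawX n.+1 isT). Qed.

Let mZs n i : measurable_fun setT (Zs n.+1 i).
Proof. by case: (@lawZ n.+1 i isT). Qed.

Let SI j : setI_closed (S j).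
Proof. case: j => [t|[t i]]; exact: sigma_of_setI. Qed.

Let ST j : S j setT.
Proof. case: j => [t|[t i]]; exact: sigma_of_setT. Qed.

Let Sm j : S j `<=` measurable.
Proof. by case: j => [t|[t i]]; exact: sigma_of_measurable. Qed.

Let Sgen (J : set (nat + nat * 'I_m)) j : J j ->
  S j `<=` <<s \bigcup_(i in J) S i >>.
Proof. by move=> Jj A SA; apply: sub_sigma_algebra; exists j. Qed.

Let gen_measurable (J : set (nat + nat * 'I_m)) :
  <<s \bigcup_(i in J) S i >> `<=` measurable.
Proof.
apply: smallest_sub; first exact: sigma_algebra_measurable.
by move=> A [j _ /Sm].
Qed.

Let mXg J n : J (inl n) ->
  measurable_fun (setT : set (g_sigma_algebraType (\bigcup_(i in J) S i)))
    (Xs n.+1).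
Proof. by move=> Jn; apply: measurable_fun_generated; exact: (@Sgen J (inl n)
    Jn). Qed.

Let mZg J n i : J (inr (n, i)) ->
  measurable_fun (setT : set (g_sigma_algebraType (\bigcup_(i in J) S i)))
    (Zs n.+1 i).
Proof. by move=> Jn; apply: measurable_fun_generated; exact: (@Sgen J (inr (n,
    i)) Jn). Qed.

Let alphat0 n : 0 < alphat n.+1.
Proof. exact: step_size_gt0. Qed.

Let K0 : 0 < d%:R * Num.sqrt d%:R :> R.
Proof. by rewrite mulr_gt0 ?sqrtr_gt0 ?ltr0n. Qed.

Let ut0 n : 0 < ut n.+1.
Proof.
rewrite -(pmulr_lgt0 _ LP0) -(pmulr_lgt0 _ K0) smoothingE//.
by rewrite !mulr_gt0// invr_gt0.
Qed.

Let ut_le n : ut n.+1 <= ut 1.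
Proof.
rewrite -(ler_pM2r LP0) -(ler_pM2r K0) !smoothingE//.
by rewrite ler_pM2l ?mulr_gt0// invr1 invf_le1// ler1n.
Qed.

Let theta_Theta n w : Theta (theta n.+1 w).
Proof. by case: n => [|n]; [rewrite theta_1|have [] := @theta_S n.+1 w isT].
    Qed.

Let Theta_star : Theta thetastar. Proof. by case: fmin. Qed.

(** The step before projection. The iterate [y] is an argument separate from [w], so that it can be
    frozen while the samples vary. *)
Let forward n y w : 'rV[R]_d := y - alphat n.+1 *:
  grad_estimate F (ut n.+1) y (Xs n.+1 w) (fun i => Zs n.+1 i w).

Let theta_variational n w b : Theta b ->
  0 <= dotp (theta n.+2 w - forward n (theta n.+1 w) w) (b - theta n.+2 w).
Proof. by move=> Tb; exact: prox_variational (@theta_S n.+1 w isT) Tb. Qed.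

Let theta_nonexpansive n w w' : l2norm (theta n.+2 w - theta n.+2 w') <=
  l2norm (forward n (theta n.+1 w) w - forward n (theta n.+1 w') w').
Proof. by apply: variational_nonexpansive; exact: theta_variational. Qed.

Let theta_dist n w : l2norm (theta n.+2 w - thetastar) <=
  l2norm (forward n (theta n.+1 w) w - thetastar).
Proof.
apply: variational_nonexpansive; first exact: theta_variational.
by rewrite subrr dotp0l.
Qed.

(** By induction [forward] at [theta n.+1] is measurable for the past, and the next iterate depends
    on it nonexpansively. *)
Let theta_past n :
  measurable_fun (setT : set (g_sigma_algebraType (past n))) (theta n.+1).
Proof.
elim: n => [|n IH].
  rewrite (_ : theta 1 = cst theta1); first exact: measurable_cst.
  by apply/funext => w; rewrite theta_1.
have mth : measurable_fun (setT : set (g_sigma_algebraType (past n.+1)))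
    (theta n.+1).
  apply: measurable_fun_generated => A /(sigma_of_generated IH).
  by apply: sub_sigma_algebra2; apply: bigcup_subset => j /= jn; exact: ltnW.
pose y w := forward n (theta n.+1 w) w.
apply: (@measurable_nonexpansive _ _ _ (g_sigma_algebraType (past n.+1)) y).
  apply: measurable_rVB => //; apply: measurable_rVZ => //.
  apply: measurable_grad_estimate => //.
    exact: (@mXg [set j | (time j < n.+1)%N] n (ltnSn n)).
  by move=> i; exact: (@mZg [set j | (time j < n.+1)%N] n i (ltnSn n)).
exact: theta_nonexpansive.
Qed.

Let theta_measurable n : measurable_fun setT (theta n.+1).
Proof.
move=> _ A mA; rewrite setTI.
have : sigma_of (theta n.+1) (theta n.+1 @^-1` A).
  by exists A => //; rewrite setTI.
by move=> /(sigma_of_generated (@theta_past n)) /gen_measurable.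
Qed.

Let indep_present n : indep_systems Pr (sigma_of (theta n.+1))
  <<s present n >>.
Proof.
apply: indep_systemsS (indep_groups SI ST Sm indep (J1 := [set j | (time j <
    n)%N])
  (J2 := [set j | time j = n]) _) => //.
  exact: (sigma_of_generated (@theta_past n)).
by apply/seteqP; split => // j [/= jn jE]; rewrite jE ltnn in jn.
Qed.

Let XZ n : indep_systems Pr (sigma_of (Xs n.+1))
  <<s \bigcup_i sigma_of (Zs n.+1 i) >>.
Proof.
apply: indep_systemsS (indep_groups SI ST Sm indep (J1 := [set inl n])
  (J2 := [set j | exists i, j = inr (n, i)]) _).
- exact: (@Sgen _ (inl n)).
- apply: sub_sigma_algebra2 => A [i _ SA].
  by exists (inr (n, i)) => //; exists i.
- by apply/seteqP; split => // j [-> [i]].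
Qed.

Let ZZ n i j : i != j ->
  indep_systems Pr (sigma_of (Zs n.+1 i)) (sigma_of (Zs n.+1 j)).
Proof.
move=> ij; apply: indep_systemsS (indep_groups SI ST Sm indep
  (J1 := [set inr (n, i)]) (J2 := [set inr (n, j)]) _).
- exact: (@Sgen _ (inr (n, i))).
- exact: (@Sgen _ (inr (n, j))).
- by apply/seteqP; split => // k [-> [] /eqP]; rewrite (negbTE ij).
Qed.

Let has_mean_L2 : has_mean P (fun x => L x ^+ 2) (LP ^+ 2).
Proof.
have E0 : (0 <= 'E_P[(fun x => L x ^+ 2)%R])%E.
  by rewrite unlock; apply: integral_ge0 => x _; rewrite lee_fin sqr_ge0.
have Efin : 'E_P[(fun x => L x ^+ 2)%R]%E \is a fin_num by rewrite ge0_fin_numE.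
rewrite /LP sqr_sqrtr ?fine_ge0//; split; last by rewrite fineK// unlock.
apply/integrableP; split.
  by apply/measurable_EFinP; exact: measurable_funX.
move: L2; rewrite unlock; congr (_ < _)%E; apply: eq_integral => x _ /=.
by rewrite ger0_norm// sqr_ge0.
Qed.

Let f_fin th : Theta th -> f th = (fine (f th))%:E.
Proof. by move=> /sub_f[fin _]; rewrite fineK. Qed.

Let gap th : R := fine (f th) - fine (f thetastar).

Let gap_ge0 th : Theta th -> 0 <= gap th.
Proof.
move=> Tth; rewrite subr_ge0 -lee_fin -!f_fin//.
by case: fmin => _; apply.
Qed.

Let gap_le_dotp th : Theta th -> gap th <=
  dotp (\row_i fine 'E_P[(fun x => g th x 0 i)%R]) (th - thetastar).
Proof.
move=> Tth; have [_ /(_ thetastar)] := sub_f Tth.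
rewrite (f_fin Tth) (f_fin Theta_star) -EFinD lee_fin -opprB dotpNr /gap; lra.
Qed.

Let uG n : R := u * G * n.+1%:R^-1.
Let c n : R := 2 * alphat n.+1 * (uG n * rad) +
  2 * alphat n.+1 ^+ 2 * ((1 + d%:R / m%:R) * G ^+ 2) +
  2 * alphat n.+1 ^+ 2 * uG n ^+ 2.

(** The second coordinate is the outcome itself under the smaller sigma-algebra of the present
    samples. This avoids packing [X] and the [m] directions into one product space, yet keeps
    independence from the iterate. *)
Let Phi n (z : 'rV[R]_d * g_sigma_algebraType (present n)) : \bar R :=
  (l2norm (forward n z.1 z.2 - thetastar) ^+ 2)%:E.

Let Phi_ge0 n z : (0 <= @Phi n z)%E.
Proof. by rewrite lee_fin sqr_ge0. Qed.

Let measurable_Phi n : measurable_fun setT (@Phi n).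
Proof.
apply/measurable_EFinP; apply: measurable_funX.
apply: (measurableT_comp measurable_l2norm); apply: measurable_rVB => //.
apply: measurable_rVB => //; apply: measurable_rVZ => //.
apply: measurable_grad_estimate => //.
  have mx : measurable_fun (setT : set (g_sigma_algebraType (present n)))
    (Xs n.+1) by exact: (@mXg [set j | time j = n]).
  exact: (measurableT_comp mx measurable_snd).
move=> i; have mz : measurable_fun (setT : set (g_sigma_algebraType (present
    n)))
  (Zs n.+1 i) by exact: (@mZg [set j | time j = n]).
exact: (measurableT_comp mz measurable_snd).
Qed.

(** Conditional mean of the squared distance after the step given that the iterate is [y], as a
    plain integral with [y] frozen. *)
Let Ist n y : \bar R := (\int[Pr]_w Phi (y, (w : g_sigma_algebraType (present
    n))))%E.

Let Ist_le n y : Theta y ->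
  (Ist n y <= (l2norm (y - thetastar) ^+ 2 - 2 * alphat n.+1 * gap y + c
      n)%:E)%E.
Proof.
move=> Ty.
have dom1 x z : l2norm z = Num.sqrt d%:R -> edom (F ^~ x) (y + ut 1%N *: z).
  by move=> zd; apply: dom => //; exact: msupport_sphere zd.
have := expected_step d0 m0 (@lawX n.+1 isT) (fun i => @lawZ n.+1 i isT)
  mu_unif (@XZ n) (@ZZ n) mF Fconv Flip L0 LP0 has_mean_L2 (@ut0 n) (@ut_le n)
  dom1 (mg Ty) (sub_g Ty) (@alphat0 n) (Theta_rad Ty) (gG Ty) (gap_le_dotp Ty).
rewrite smoothingE// -/(uG n) /c !addrA; exact.
Qed.

Let Ist_ge0 n y : (0 <= Ist n y)%E.
Proof. exact: integral_ge0. Qed.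

Let it n w : R := fine (Ist n (theta n.+1 w)).

Let itE n w : Ist n (theta n.+1 w) = (it n w)%:E.
Proof.
rewrite /it fineK// ge0_fin_numE//.
exact: le_lt_trans (Ist_le n (theta_Theta n w)) (ltry _).
Qed.

(** The index [t.-1.+1] sends 0 to 1: [theta 0] is unconstrained, while the telescoping bound asks
    for estimates on [D] at every [t]. *)
Let D t : R := fine (\int[Pr]_w (l2norm (theta t.-1.+1 w - thetastar) ^+ 2)%:E).

Let has_mean_dist n : has_mean Pr
  (fun w => l2norm (theta n.+1 w - thetastar) ^+ 2) (D n.+1).
Proof.
apply: (has_mean_bounded (B := rad ^+ 2)).
  apply: measurable_funX; apply: (measurableT_comp measurable_l2norm).
  exact: measurable_rVB.
apply: aeW => w; rewrite ger0_norm ?sqr_ge0// ler_pXn2r ?nnegrE ?l2norm_ge0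
    ?(ltW rad0)//.
exact/Theta_rad/theta_Theta.
Qed.

Let D_bounds t : 0 <= D t <= rad ^+ 2.
Proof.
have Dt := has_mean_dist t.-1; apply/andP; split.
  by apply: has_mean_le (has_mean_cst Pr 0) Dt _ => w; exact: sqr_ge0.
apply: has_mean_le Dt (has_mean_cst Pr (rad ^+ 2)) _ => w.
rewrite ler_pXn2r ?nnegrE ?l2norm_ge0 ?(ltW rad0)//.
exact/Theta_rad/theta_Theta.
Qed.

Let mid n : measurable_fun setT (id : W -> g_sigma_algebraType (present n)).
Proof.
by move=> _ A mA; rewrite setTI; exact: (@gen_measurable [set j | time j = n]).
Qed.

Let indep_id n : indep_systems Pr (sigma_of (theta n.+1))
  (sigma_of (id : W -> g_sigma_algebraType (present n))).
Proof.
apply: indep_systemsS (@indep_present n) => //.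
by move=> _ [B mB <-]; rewrite setTI.
Qed.

(** By Tonelli [b] is the mean squared distance of the unprojected step from the minimizer, and
    projecting does not increase that distance. *)
Let has_mean_it n : exists2 b, has_mean Pr (it n) b & D n.+2 <= b.
Proof.
have mI : measurable_fun setT (it n).
  have mIst : measurable_fun setT (Ist n).
    exact: (measurable_integral_indep Pr (@mid n) (@measurable_Phi n) (@Phi_ge0
        n)).
  have mfine : measurable_fun setT (fine : \bar R -> R) by [].
  exact: (measurableT_comp mfine (measurableT_comp mIst (@theta_measurable n))).
have hI : has_mean Pr (it n) (fine (\int[Pr]_w (it n w)%:E)).
  apply: (has_mean_bounded (B := rad ^+ 2 + c n)) => //.
  apply: aeW => w; have Tw := theta_Theta n w.
  have := Ist_le n Tw; have := Ist_ge0 n (theta n.+1 w).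
  rewrite itE !lee_fin => i0 ile; rewrite ger0_norm// (le_trans ile)//.
  have : 0 <= 2 * alphat n.+1 * gap (theta n.+1 w).
    by rewrite mulr_ge0 ?gap_ge0// mulr_ge0// ltW.
  have : l2norm (theta n.+1 w - thetastar) ^+ 2 <= rad ^+ 2.
    by rewrite ler_pXn2r ?nnegrE ?l2norm_ge0 ?(ltW rad0)//; exact: Theta_rad.
  lra.
eexists; first exact: hI.
have [_ eD] := has_mean_dist n.+1; have [_ eI] := hI.
rewrite -lee_fin -eD -eI.
have -> : (\int[Pr]_w (it n w)%:E = \int[Pr]_w Ist n (theta n.+1 w))%E.
  by apply: eq_integral => w _; rewrite itE.
rewrite -(ge0_integral_indep (@theta_measurable n) (@mid n) (@indep_id n)
  (@measurable_Phi n) (@Phi_ge0 n)).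
apply: ge0_le_integral => //.
- by move=> w _; rewrite lee_fin sqr_ge0.
- exact: measurable_int (has_mean_dist n.+1).1.
- apply: (measurableT_comp (@measurable_Phi n)).
  exact: (measurable_fun_pair (@theta_measurable n) (@mid n)).
by move=> w _; rewrite lee_fin ler_pXn2r ?nnegrE ?l2norm_ge0//.
Qed.

Lemma expected_gap_le (k : nat) : (0 < k)%N ->
  (\int[Pr]_w (f (k%:R^-1 *: \sum_(1 <= t < k.+1) theta t w) - f thetastar) <=
   (5 * (rad * G * Num.sqrt (1 + d%:R / m%:R) / Num.sqrt k%:R) *
    (Num.max alpha alpha^-1 + alpha * u ^+ 2 * (Num.sqrt k%:R)^-1 +
     u * (ln (2 * k%:R) / k%:R)))%:E)%E.
Proof.
move=> k0; have kpos : 0 < k%:R :> R by rewrite ltr0n.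
(* The conditional step inequality solved for the gap. Unlike the gap itself, [H n] is known to have
   a mean. *)
pose H n w := (2 * alphat n.+1)^-1 *
  (l2norm (theta n.+1 w - thetastar) ^+ 2 + c n + -1 * it n w).
have gapH n w : gap (theta n.+1 w) <= H n w.
  have := Ist_le n (theta_Theta n w); rewrite itE lee_fin /H.
  have := @alphat0 n; move: (alphat n.+1) (gap _) (it n w) (c n) => a y i e a0
      h.
  by rewrite ler_pdivlMl ?mulr_gt0//; lra.
have hH n : exists2 b, has_mean Pr (H n) b &
    b <= (D n.+1 - D n.+2 + c n) / (2 * alphat n.+1).
  have [b hb Db] := has_mean_it n.
  exists ((2 * alphat n.+1)^-1 * (D n.+1 + c n + -1 * b)).
    apply: has_meanZ; apply: has_meanD; last exact: has_meanZ.
    by apply: has_meanD; [exact: has_mean_dist|exact: has_mean_cst].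
  move: Db (@alphat0 n).
  move: (alphat n.+1) (D n.+2) (D n.+1) (c n) => a D2 D1 e Db a0.
  by rewrite mulrC ler_pM2r ?invr_gt0 ?mulr_gt0//; lra.
pose thetahat w := k%:R^-1 *: \sum_(1 <= t < k.+1) theta t w.
have Thetahat w : Theta (thetahat w).
  by apply: convex_set_average => // -[//|n] _; exact: theta_Theta.
have gaphat w : gap (thetahat w) <=
    k%:R^-1 * \sum_(1 <= t < k.+1) H t.-1 w.
  rewrite ler_pdivlMl//.
  apply: (@le_trans _ _ (\sum_(1 <= t < k.+1) gap (theta t w))); last first.
    by apply: ler_sum_nat => -[//|n] _; exact: gapH.
  (* Jensen through a single subgradient [V] of [f] at the average: its linear terms cancel because
     the deviations from the average sum to zero. *)
  have [_] := sub_f (Thetahat w); set V := \row_i _ => sV.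
  have : \sum_(1 <= t < k.+1) (gap (thetahat w) +
      dotp V (theta t w - thetahat w)) <= \sum_(1 <= t < k.+1) gap (theta t w).
    apply: ler_sum_nat => -[//|n] _; have Tn := theta_Theta n w.
    have := sV (theta n.+1 w).
    rewrite (f_fin (Thetahat w)) (f_fin Tn) -EFinD lee_fin /gap; lra.
  have avg : \sum_(1 <= t < k.+1) (theta t w - thetahat w) = 0.
    rewrite sumrB sumr_const_nat subSS subn0 /thetahat -scaler_nat scalerA.
    by rewrite divff ?gt_eqF// scale1r subrr.
  apply: le_trans; rewrite big_split/= -dotp_sumr avg dotp0r addr0.
  by rewrite sumr_const_nat subSS subn0 mulr_natl.
pose b n := sval (cid2 (hH n)).
have hb n : has_mean Pr (H n) (b n) by rewrite /b; case: cid2.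
have b_le n : b n <= (D n.+1 - D n.+2 + c n) / (2 * alphat n.+1).
  by rewrite /b; case: cid2.
have hsum := has_meanZ k%:R^-1
  (has_mean_sum (index_iota 1 k.+1) (fun t => hb t.-1)).
apply: le_trans (ge0_integral_le_mean _ _ hsum) _.
- move=> w; rewrite -/(thetahat w) (f_fin (Thetahat w)) (f_fin Theta_star).
  by rewrite -EFinB lee_fin; exact: gap_ge0.
- move=> w; rewrite -/(thetahat w) (f_fin (Thetahat w)) (f_fin Theta_star).
  by rewrite -EFinB lee_fin; exact: gaphat.
rewrite lee_fin.
have := average_gap_le d m rad0 G0 alpha0 u0 k0 D_bounds.
apply: le_trans; rewrite ler_pM2l ?invr_gt0//.
by rewrite !big_add1; apply: ler_sum => n _; exact: b_le.
Qed.

End StochasticMirrorDescent.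

Theorem corollary2 (R : realType) :
  exists2 C : R, C <= 5 &
  forall (d : nat) (dX : measure_display) (X : measurableType dX)
    (P : probability X R) (Theta : set 'rV[R]_d)
    (F : 'rV[R]_d -> X -> \bar R) (thetastar : 'rV[R]_d)
    (g : 'rV[R]_d -> X -> 'rV[R]_d) (L : X -> R)
    (rad G : R) (mu : probability 'rV[R]_d R) (m : nat) (alpha u : R)
    (dW : measure_display) (W : measurableType dW) (Pr : probability W R)
    (Xs : nat -> W -> X) (Zs : nat -> 'I_m -> W -> 'rV[R]_d)
    (theta1 : 'rV[R]_d) (theta : nat -> W -> 'rV[R]_d),
  let f := fun th : 'rV[R]_d => (\int[P]_x F th x)%E in
  let LP := Num.sqrt (fine 'E_P[(fun x => L x ^+ 2)%R]%E) in
  let ut := smoothing d G LP u in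
  let alphat := step_size d m rad G alpha in
  (0 < d)%N ->
  compact Theta ->
  convex_set (Theta : set (convex_lmodType 'rV[R]_d)) ->
  measurable_fun setT (fun p : 'rV[R]_d * X => F p.1 p.2) ->
  {ae P, forall x, closed_convex_fun (F ^~ x)} ->
  is_argmin Theta f thetastar ->
  (forall th, Theta th -> measurable_fun setT (g th)) ->
  (forall th, Theta th ->
     {ae P, forall x, subdifferential (F ^~ x) th (g th x)}) ->
  (forall th, Theta th ->
     subdifferential f th (\row_i fine 'E_P[(fun x => g th x 0 i)%R]%E)) ->
  0 < rad -> 0 < G ->
  (forall th, Theta th -> l2norm (th - thetastar) <= rad) ->
  (forall (x : X) (th z : 'rV[R]_d), Theta th -> msupport mu z ->
     edom (F ^~ x) (th + ut 1%N *: z)) ->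
  measurable_fun setT L ->
  (forall x, 0 <= L x) ->
  {ae P, forall x, lipschitz_gradient (F ^~ x) (L x)} ->
  ('E_P[(fun x => L x ^+ 2)%R]%E < +oo)%E ->
  0 < LP ->
  (forall th, Theta th -> l2norm th <= rad) ->
  uniform_on_sphere mu (Num.sqrt d%:R) ->
  (forall th, Theta th ->
     ('E_P[(fun x => l2norm (g th x) ^+ 2)%R]%E <= (G ^+ 2)%:E)%E) ->
  (0 < m)%N -> 0 < alpha -> 0 < u ->
  (forall t, (0 < t)%N -> has_law Pr (Xs t) P) ->
  (forall t i, (0 < t)%N -> has_law Pr (Zs t i) mu) ->
  mutually_independent Pr (sample_sigma Xs Zs) ->
  Theta theta1 ->
  (forall w, theta 1%N w = theta1) ->
  (forall t w, (0 < t)%N ->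
     is_argmin Theta
       (prox_objective (alphat t)
          (grad_estimate F (ut t) (theta t w) (Xs t w) (fun i => Zs t i w))
          (theta t w))
       (theta t.+1 w)) ->
  forall k : nat, (0 < k)%N ->
  let thetahat := fun w => k%:R^-1 *: \sum_(1 <= t < k.+1) theta t w in
  (\int[Pr]_w (f (thetahat w) - f thetastar) <=
   (C * (rad * G * Num.sqrt (1 + d%:R / m%:R) / Num.sqrt k%:R) *
    (Num.max alpha alpha^-1 + alpha * u ^+ 2 * (Num.sqrt k%:R)^-1 +
     u * (ln (2 * k%:R) / k%:R)))%:E)%E.
Proof.
exists 5 => // d dX X P Theta F thetastar g L rad G mu m alpha u dW W Pr Xs Zs.
move=> theta1 theta f LP ut alphat d0 _ convTheta mF Fconv fmin mg sub_g sub_f.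
move=> rad0 G0 Theta_rad dom mL L0 Flip L2 LP0 _ mu_unif gG m0 alpha0 u0.
move=> lawX lawZ indep Theta1 theta_1 theta_S k k0 /=.
exact: (expected_gap_le d0 convTheta mF Fconv fmin mg sub_g sub_f rad0 G0
  Theta_rad dom mL L0 Flip L2 LP0 mu_unif gG m0 alpha0 u0 lawX lawZ indep Theta1
  theta_1 theta_S k0).
Qed.
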